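(* Let $n\ge2$, let $\alpha\in(0,1]$, and let $E$ and $E_k$ ($k\in\mathbb{N}$) be bounded open subsets of $\mathbb{R}^n$ with $C^{1,\alpha}$ boundary such that $E_k\to E$ in $C^{1,\alpha}$. Let $x_k\in\partial E_k$ and $x\in\partial E$ be such that $x_k\to x$. Then $$\mathcal{I}_s[E_k](x_k)\longrightarrow\mathcal{I}_s[E](x)\qquad\text{for every }s\in(0,\alpha).$$ In particular, if the boundaries are of class $C^2$ and the convergence $E_k\to E$ is in the $C^2$ sense, then this convergence holds for every $s\in(0,1)$.
   Context: For $s\in(0,1)$ the $s$-fractional mean curvature of $\partial E$ at $x\in\partial E$ is $\mathcal{I}_s[E](x):=\lim_{\rho\to0}\int_{\mathbb{R}^n\setminus B_\rho(x)}\frac{\chi_E(y)-\chi_{\mathcal{C}E}(y)}{|x-y|^{n+s}}\,dy$, with $\mathcal{C}E$ the complement of $E$ (the limit exists under the stated regularity). $E_k\to E$ in $C^{1,\alpha}$ (respectively $C^2$) means: $|E_k\Delta E|\to0$ and the boundaries converge in the $C^{1,\alpha}$ (resp. $C^2$) sense, i.e. $\partial E$ and, for $k$ large, $\partial E_k$ are covered by finitely many fixed open cylinders in each of which, in suitable orthonormal coordinates, $E$ and $E_k$ are the subgraphs of functions $u$ and $u_k$ of class $C^{1,\alpha}$ (resp. $C^2$), with $u_k\to u$ in $C^{1,\alpha}$ (resp. $C^2$). *)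

(* Defs.v *)
From HB Require Import structures.
From mathcomp Require Import all_boot all_order all_algebra.
From mathcomp Require Import all_classical all_reals all_analysis.

Set Implicit Arguments.
Unset Strict Implicit.
Unset Printing Implicit Defensive.

Import Order.TTheory GRing.Theory Num.Theory.
Import numFieldNormedType.Exports.

Local Open Scope classical_set_scope.
Local Open Scope ring_scope.

(** Lebesgue measure on n.-tuple R, obtained by transporting the product
    measures lebesgue \x (lebesgue \x ...) along (x, t) |-> x :: t. *)

Section cons_measure.
Context d (T : measurableType d) (R : realType) (n : nat).
Variable m1 : {sigma_finite_measure set T -> \bar R}.
Variable m2 : {sigma_finite_measure set (n.-tuple T) -> \bar R}.

Definition tuple_cons (p : T * n.-tuple T) : n.+1.-tuple T :=
  [tuple of p.1 :: p.2].

Definition tuple_uncons (t : n.+1.-tuple T) : T * n.-tuple T :=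
  (tnth t ord0, [tuple of behead t]).

Lemma tuple_consK : cancel tuple_cons tuple_uncons.
Proof. by move=> [x t]; congr (_, _); exact/val_inj. Qed.

Lemma measurable_tuple_cons : measurable_fun setT tuple_cons.
Proof.
apply: (@measurable_cons _ _ _ _ (fst : T * n.-tuple T -> T) n snd).
- exact: measurable_fst.
- exact: measurable_snd.
Qed.

Lemma measurable_tuple_uncons : measurable_fun setT tuple_uncons.
Proof.
apply: measurable_fun_pair.
- exact: measurable_tnth.
- exact: measurable_behead.
Qed.

Definition cons_measure : set (n.+1.-tuple T) -> \bar R :=
  pushforward (m1 \x m2)%E tuple_cons.

Let cons_measure0 : cons_measure set0 = 0%E.
Proof. by rewrite /cons_measure /pushforward preimage_set0 measure0. Qed.

Let cons_measure_ge0 A : (0 <= cons_measure A)%E.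
Proof. by rewrite /cons_measure /pushforward; exact: measure_ge0. Qed.

Let cons_measure_sigma_additive : semi_sigma_additive cons_measure.
Proof.
move=> F mF tF mUF; rewrite /cons_measure /pushforward preimage_bigcup.
have mc A : measurable A -> measurable (tuple_cons @^-1` A).
  by move=> mA; rewrite -[X in measurable X]setTI; exact: measurable_tuple_cons.
apply: measure_semi_sigma_additive.
- by move=> i; exact: (mc _ (mF i)).
- apply/trivIsetP => /= i j _ _ ij; rewrite -preimage_setI.
  by move/trivIsetP : tF => /(_ _ _ _ _ ij) ->//; rewrite preimage_set0.
- by rewrite -preimage_bigcup; exact: mc.
Qed.

HB.instance Definition _ := isMeasure.Build _ _ _ cons_measure
  cons_measure0 cons_measure_ge0 cons_measure_sigma_additive.

Let cons_measure_sigma_finite : sigma_finite setT cons_measure.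
Proof.
have /sigma_finiteP[F [TF ndF Foo]] := sigma_finiteT m1.
have /sigma_finiteP[G [TG ndG Goo]] := sigma_finiteT m2.
exists (fun k => tuple_uncons @^-1` (F k `*` G k)).
  rewrite -preimage_bigcup (_ : \bigcup_k _ = setT) ?preimage_setT//.
  rewrite -setXTT TF TG predeqE => -[x y]; split.
    by move=> [k _ []/= ? ?]; split; exists k.
  move=> [/= [k _ Fkx] [l _ Gly]]; exists (maxn k l) => //; split.
  - by move: x Fkx; exact/subsetPset/ndF/leq_maxl.
  - by move: y Gly; exact/subsetPset/ndG/leq_maxr.
move=> k; have [mF Fk] := Foo k; have [mG Gk] := Goo k; split.
  rewrite -[X in measurable X]setTI; apply: measurable_tuple_uncons => //.
  exact: measurableX.
rewrite /cons_measure /pushforward -comp_preimage (_ : _ \o _ = id); last first.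
  by apply/funext; exact: tuple_consK.
by rewrite preimage_id product_measure1E// lte_mul_pinfty// ge0_fin_numE.
Qed.

HB.instance Definition _ := Measure_isSigmaFinite.Build _ _ _ cons_measure
  cons_measure_sigma_finite.

End cons_measure.

Fixpoint lebesgue_tuple (R : realType) (n : nat) :
    {sigma_finite_measure set (n.-tuple (measurableTypeR R)) -> \bar R} :=
  match n return
    {sigma_finite_measure set (n.-tuple (measurableTypeR R)) -> \bar R} with
  | 0 => \d_ [tuple]
  | m.+1 => cons_measure (@lebesgue_measure R) (lebesgue_tuple R m)
  end.

Section euclidean.
Context (R : realType) (n : nat).

Definition row_of (t : n.-tuple R) : 'rV[R]_n := \row_i tnth t i.

Definition volume (A : set 'rV[R]_n) : \bar R :=
  lebesgue_tuple R n (row_of @^-1` A).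

(** The norm [`|v|] of the library on ['rV[R]_n] is the sup norm. *)
Definition enorm (v : 'rV[R]_n) : R := Num.sqrt (\sum_i v 0 i ^+ 2).

Definition bdry (A : set 'rV[R]_n) : set 'rV[R]_n := closure A `\` A°.

Definition frac_mean_curv (s : R) (E : set 'rV[R]_n) (x : 'rV[R]_n) : R :=
  lim ((\int[lebesgue_tuple R n]_(t in [set t | rho <= enorm (x - row_of t)])
          ((\1_E (row_of t) - \1_(~` E) (row_of t)) /
             enorm (x - row_of t) `^ (n%:R + s))) @[rho --> 0^'+]).

End euclidean.

(** Regularity classes and norms on an open set [D] of R^m. *)

Section regularity.
Context (R : realType) (m : nat).
Implicit Types (D : set 'rV[R]_m) (u : 'rV[R]_m -> R).

Definition partial (i : 'I_m) u : 'rV[R]_m -> R := 'D_(delta_mx 0 i) u.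

Fixpoint is_Ck (k : nat) D u : Prop :=
  {in D, continuous u} /\
  if k is j.+1 then
    forall i : 'I_m, (forall y, D y -> derivable u y (delta_mx 0 i)) /\
                     is_Ck j D (partial i u)
  else True.

Definition sup_norm D u : \bar R := ereal_sup [set `|u y|%:E | y in D].

(** The norm of order [k]: the sum of the sup norms on [D] of all iterated
    partial derivatives of order at most [k]. *)
Fixpoint Ck_norm (k : nat) D u : \bar R :=
  (sup_norm D u +
   if k is j.+1 then \sum_(i < m) Ck_norm j D (partial i u) else 0)%E.

Definition holder_seminorm (a : R) D u : \bar R :=
  ereal_sup [set e | exists y z, [/\ D y, D z, y != z &
                       e = (`|u y - u z| / enorm (y - z) `^ a)%:E]].

Definition C1a_norm (a : R) D u : \bar R :=
  (Ck_norm 1 D u + \sum_(i < m) holder_seminorm a D (partial i u))%E.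

Definition is_C1a (a : R) D u : Prop :=
  is_Ck 1 D u /\ forall i, (holder_seminorm a D (partial i u) < +oo)%E.

End regularity.

(** Open cylinders of R^n in orthonormal coordinates: the rows of [cyl_horiz]
    followed by [cyl_vert] form an orthonormal basis when [0 < n]. *)

Record cylinder (R : realType) (n : nat) := Cylinder {
  cyl_center : 'rV[R]_n;
  cyl_horiz : 'M[R]_(n.-1, n);
  cyl_vert : 'rV[R]_n;
  cyl_radius : R;
  cyl_height : R;
  cyl_orthonormal :
    col_mx cyl_horiz cyl_vert *m (col_mx cyl_horiz cyl_vert)^T = 1%:M;
  cyl_radius_gt0 : 0 < cyl_radius;
  cyl_height_gt0 : 0 < cyl_height }.

Section graphs.
Context (R : realType) (n : nat).
Implicit Types (C : cylinder R n) (E : set 'rV[R]_n) (u : 'rV[R]_n.-1 -> R).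

Definition hcoord C (z : 'rV[R]_n) : 'rV[R]_n.-1 :=
  (z - cyl_center C) *m (cyl_horiz C)^T.

Definition vcoord C (z : 'rV[R]_n) : R :=
  ((z - cyl_center C) *m (cyl_vert C)^T) 0 0.

Definition cyl_base C : set 'rV[R]_n.-1 := [set y | enorm y < cyl_radius C].

Definition cyl_set C : set 'rV[R]_n :=
  [set z | cyl_base C (hcoord C z) /\ `|vcoord C z| < cyl_height C].

Definition subgraph_in C E u : Prop :=
  E `&` cyl_set C = [set z | cyl_set C z /\ vcoord C z < u (hcoord C z)].

(** [class D u]: [u] has the regularity under consideration on [D]. *)
Definition boundary_of_class
    (class : set 'rV[R]_n.-1 -> ('rV[R]_n.-1 -> R) -> Prop) E : Prop :=
  forall x, bdry E x -> exists C u,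
    [/\ cyl_set C x, class (cyl_base C) u & subgraph_in C E u].

Definition set_cvg
    (class : set 'rV[R]_n.-1 -> ('rV[R]_n.-1 -> R) -> Prop)
    (norm : set 'rV[R]_n.-1 -> ('rV[R]_n.-1 -> R) -> \bar R)
    (E_ : nat -> set 'rV[R]_n) E : Prop :=
  volume (E_ k `+` E) @[k --> \oo] --> 0%E /\
  exists (N : nat) (C : 'I_N -> cylinder R n)
         (u : 'I_N -> 'rV[R]_n.-1 -> R) (u_ : nat -> 'I_N -> 'rV[R]_n.-1 -> R),
    [/\ bdry E `<=` \bigcup_i cyl_set (C i),
        \forall k \near \oo, bdry (E_ k) `<=` \bigcup_i cyl_set (C i) &
        forall i, let D := cyl_base (C i) in
          [/\ class D (u i) /\ subgraph_in (C i) E (u i),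
              \forall k \near \oo,
                class D (u_ k i) /\ subgraph_in (C i) (E_ k) (u_ k i) &
              norm D (u_ k i \- u i) @[k --> \oo] --> 0%E]].

Definition C1a_boundary (a : R) := boundary_of_class (is_C1a a).
Definition C2_boundary := boundary_of_class (@is_Ck R n.-1 2).
Definition C1a_cvg (a : R) := set_cvg (is_C1a a) (C1a_norm a).
Definition C2_cvg := set_cvg (@is_Ck R n.-1 2) (@Ck_norm R n.-1 2).

End graphs.

(* Main.v *)
From HB Require Import structures.
Require Import Defs.
From mathcomp Require Import all_boot all_order all_algebra.
From mathcomp Require Import all_classical all_reals all_analysis measurable_realfun.
From mathcomp Require Import ring lra.
Import Order.TTheory GRing.Theory Num.Theory.
Import numFieldNormedType.Exports.
Local Open Scope classical_set_scope.
Local Open Scope ring_scope.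

(** With [p = n + s], replace the singular kernel [|x - y| ^ (- p)] by the
    bounded kernel [max (|x - y|, d) ^ (- p)].  The resulting quantity depends continuously on
    the set (for the volume of the symmetric difference) and on [x] (dominated
    convergence).  The error made is [O (d ^ (a - s))], uniformly along the
    sequence: it is an integral of [chi_E - chi_(CE)] against a kernel that is
    symmetric about [x] and supported near [x], so that only the points [y] such
    that [y] and [2x - y] lie on the same side of the boundary contribute.  By
    the Taylor expansion of the graph, such a [y] satisfies
    [|l (y - x)| <= M |y - x| ^ (1 + a)], where the linear form [l] vanishes on
    the tangent hyperplane and has one coefficient at least [1 / n]; hence the
    dyadic shell of radius [r] contains at most [O (r ^ (n + a))] of them in
    volume, and the contributions of the shells form a geometric series.  For
    C^2 convergence the gradients of the graphs are uniformly Lipschitz near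
    [x], so that [a = 1] is allowed. *)

(** * Reflections of the Lebesgue measure on tuples *)

(** The central symmetry about [c / 2], stated on tuples because the measure lives there. *)
Definition reflect_tuple {R : realType} {n : nat} (c t : n.-tuple R) : n.-tuple R :=
  [tuple tnth c i - tnth t i | i < n].

Lemma tnth_reflect_tuple {R : realType} {n : nat} (c t : n.-tuple R) i :
  tnth (reflect_tuple c t) i = tnth c i - tnth t i.
Proof. by rewrite tnth_mktuple. Qed.

Definition reflect_real {R : realType} (c : R) : measurableTypeR R -> measurableTypeR R :=
  fun x => (c - x : R).

Lemma measurable_reflect_real {R : realType} (c : R) : measurable_fun setT (reflect_real c).
Proof. by apply: measurable_funB => //; exact: measurable_id. Qed.

(** By uniqueness of Lebesgue measure, half-open intervals suffice; reflection only exchanges which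
    endpoint is closed, so lengths are kept. *)
Lemma lebesgue_measure_reflect {R : realType} (c : R)
    (A : set (measurableTypeR R)) : measurable A ->
  lebesgue_measure (reflect_real c @^-1` A) = lebesgue_measure A.
Proof.
pose f : {mfun measurableTypeR R >-> measurableTypeR R} :=
  HB.pack (reflect_real c) (isMeasurableFun.Build _ _ _ _ _ (measurable_reflect_real c)).
move=> mA; apply/esym.
apply: (@lebesgue_measure_unique R (pushforward lebesgue_measure f)) => //.
move=> _ [[a b]] _ <- /=; rewrite /pushforward/=.
rewrite (_ : _ @^-1` _ = `[c - b, c - a[%classic); last first.
  have E (z : R) : (a < c - z <= b) = (c - b <= z < c - a).
    by apply/andP/andP => -[? ?]; split; lra.
  by apply/funext => y /=; rewrite /reflect_real !in_itv/= E.
by rewrite !lebesgue_measure_itv/= !lte_fin ltrD2l ltrN2 -!EFinB;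
   case: ifP => // _; congr EFin; ring.
Qed.

Lemma measurable_reflect_tuple {R : realType} {n : nat} (c : n.-tuple R) :
  measurable_fun setT
    (reflect_tuple c : n.-tuple (measurableTypeR R) -> n.-tuple (measurableTypeR R)).
Proof.
apply/measurable_fun_tnthP => i.
rewrite (_ : _ \o _ = fun t => tnth c i - tnth t i); last first.
  by apply/funext => t /=; rewrite tnth_reflect_tuple.
by apply: measurable_funB => //; exact: measurable_tnth.
Qed.

Lemma reflect_tuple_cons {R : realType} {n : nat} (c : n.+1.-tuple R) x
    (t : n.-tuple R) :
  reflect_tuple c (tuple_cons (x, t)) =
  tuple_cons (tnth c ord0 - x, reflect_tuple [tuple of behead c] t).
Proof.
apply: eq_from_tnth => i; rewrite tnth_reflect_tuple.
case: (unliftP ord0 i) => [j|] -> /=; last by rewrite !tnth0.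
by rewrite !tnthS tnth_reflect_tuple [in LHS](tuple_eta c) tnthS.
Qed.

(** Induction on the dimension: the reflection acts separately on head and tail, so the image
    measure agrees with the product measure on rectangles, and product measures are unique. *)
Lemma lebesgue_tuple_reflect {R : realType} {n : nat} (c : n.-tuple R)
    (A : set (n.-tuple (measurableTypeR R))) : measurable A ->
  lebesgue_tuple R n (reflect_tuple c @^-1` A) = lebesgue_tuple R n A.
Proof.
elim: n c A => [|n IH] c A mA.
  by congr (lebesgue_tuple R 0 _); apply/seteqP; split => t /=;
    rewrite (tuple0 (reflect_tuple c t)) (tuple0 t).
rewrite /= /cons_measure /pushforward.
set X := @tuple_cons _ (measurableTypeR R) n @^-1` A.
have mX : measurable X.
  by rewrite -[X]setTI; exact: (@measurable_tuple_cons _ (measurableTypeR R) n).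
pose c0 := tnth c ord0; pose c' := [tuple of behead c].
pose phi (p : measurableTypeR R * n.-tuple (measurableTypeR R)) :
  measurableTypeR R * n.-tuple (measurableTypeR R) :=
  (reflect_real c0 p.1, reflect_tuple c' p.2).
have mphi : measurable_fun setT phi.
  apply: measurable_fun_pair.
    by apply: measurableT_comp; [exact: measurable_reflect_real|exact: measurable_fst].
  apply: measurableT_comp; first exact: measurable_reflect_tuple.
  exact: measurable_snd.
pose f : {mfun (measurableTypeR R * n.-tuple (measurableTypeR R))%type >->
    (measurableTypeR R * n.-tuple (measurableTypeR R))%type} :=
  HB.pack phi (isMeasurableFun.Build _ _ _ _ _ mphi).
rewrite (_ : _ @^-1` (_ @^-1` _) = phi @^-1` X); last first.
  by apply/seteqP; split => -[x t]; rewrite /X /= reflect_tuple_cons.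
apply/esym.
apply: (@product_measure_unique _ _ _ _ R lebesgue_measure (lebesgue_tuple R n)
  (pushforward (lebesgue_measure \x lebesgue_tuple R n)%E f)) => // B C mB mC.
rewrite -[LHS]/((lebesgue_measure \x lebesgue_tuple R n)%E (phi @^-1` (B `*` C))).
rewrite (_ : _ @^-1` _ = (reflect_real c0 @^-1` B) `*` (reflect_tuple c' @^-1` C)); last first.
  by apply/seteqP; split => -[x t].
rewrite product_measure1E.
- by rewrite IH//; congr (_ * _)%E; exact: lebesgue_measure_reflect.
- by rewrite -[X in measurable X]setTI; exact: measurable_reflect_real.
- by rewrite -[X in measurable X]setTI; exact: measurable_reflect_tuple.
Qed.

(** * Volume of slabs *)

(** Cavalieri bound: the measure is the integral of the measures of the sections, which are empty
    outside [B] and at most [v] over it. *)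
Lemma product_measure1_le d1 d2 (T1 : measurableType d1) (T2 : measurableType d2)
    (R : realType) (m1 : {sigma_finite_measure set T1 -> \bar R})
    (m2 : {sigma_finite_measure set T2 -> \bar R}) (A : set (T1 * T2))
    (B : set T1) (v : R) : measurable A -> measurable B -> 0 <= v ->
  (forall p, A p -> B p.1) ->
  (forall x, B x -> (m2 (xsection A x) <= v%:E)%E) ->
  ((m1 \x m2) A <= m1 B * v%:E)%E.
Proof.
move=> mA mB v0 AB Av; rewrite /= /product_measure1.
apply: (@le_trans _ _ (\int[m1]_x ((\1_B x)%:E * v%:E))%E).
  apply: ge0_le_integral => //=.
  - exact: measurable_fun_xsection.
  - by apply: emeasurable_funM => //; exact/measurable_EFinP.
  - move=> x _; rewrite indicE; have [xB|xB] := boolP (x \in B).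
      by rewrite mul1e; apply: Av; rewrite inE in xB.
    rewrite mul0e (_ : xsection A x = set0) ?measure0//.
    rewrite -subset0 => t; rewrite /xsection/= inE => /AB/= xB'.
    by move: xB; rewrite notin_setE.
rewrite ge0_integralZr//= ?integral_indic ?setIT//.
by apply/measurable_EFinP; exact: measurable_indic.
Qed.

(** The Cavalieri bound for sections in the other direction, once the product measure is identified
    with the one integrated in the opposite order. *)
Lemma product_measure2_le d1 d2 (T1 : measurableType d1) (T2 : measurableType d2)
    (R : realType) (m1 : {sigma_finite_measure set T1 -> \bar R})
    (m2 : {sigma_finite_measure set T2 -> \bar R}) (A : set (T1 * T2))
    (B : set T2) (v : R) : measurable A -> measurable B -> 0 <= v ->
  (forall p, A p -> B p.2) ->
  (forall y, B y -> (m1 (ysection A y) <= v%:E)%E) ->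
  ((m1 \x m2) A <= v%:E * m2 B)%E.
Proof.
move=> mA mB v0 AB Av.
rewrite (_ : (m1 \x m2)%E A = (m1 \x^ m2)%E A); last first.
  by apply: product_measure_unique => //= *; rewrite product_measure2E.
rewrite /= /product_measure2.
apply: (@le_trans _ _ (\int[m2]_x (v%:E * (\1_B x)%:E))%E).
  apply: ge0_le_integral => //=.
  - exact: measurable_fun_ysection.
  - by apply: emeasurable_funM => //; exact/measurable_EFinP.
  - move=> x _; rewrite indicE; have [xB|xB] := boolP (x \in B).
      by rewrite mule1; apply: Av; rewrite inE in xB.
    rewrite mule0 (_ : ysection A x = set0) ?measure0//.
    rewrite -subset0 => t; rewrite /ysection/= inE => /AB/= xB'.
    by move: xB; rewrite notin_setE.
rewrite ge0_integralZl//= ?integral_indic ?setIT//.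
by apply/measurable_EFinP; exact: measurable_indic.
Qed.

Definition tuple_box {R : realType} {n : nat} (a : 'I_n -> R) (r : R) :
  set (n.-tuple (measurableTypeR R)) := [set t | forall i, `|a i - tnth t i| < r].

Lemma measurable_tuple_box {R : realType} {n : nat} (a : 'I_n -> R) (r : R) :
  measurable (tuple_box a r).
Proof.
rewrite (_ : tuple_box a r =
    \big[setI/setT]_(i < n) [set t | `|a i - tnth t i| < r]); last first.
  rewrite -bigcap_seq; apply/seteqP; split => t /= H i; first by move=> _; exact: H.
  by apply: H => /=; rewrite mem_index_enum.
apply: bigsetI_measurable => i _.
have mf : measurable_fun setT
    (fun t : n.-tuple (measurableTypeR R) => `|a i - tnth t i| < r).
  apply: measurable_fun_ltr => //.
  apply: measurableT_comp => //; apply: measurable_funB => //.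
  exact: measurable_tnth.
by rewrite -[X in measurable X]setTI; exact: (mf _ [set true]).
Qed.

Lemma tuple_box_cons {R : realType} {n : nat} (a : 'I_n.+1 -> R) (r : R) x t :
  tuple_box a r (tuple_cons (x, t)) <->
  `|a ord0 - x| < r /\ tuple_box (a \o lift ord0) r t.
Proof.
split=> [H|[H0 H] i].
  by split=> [|i]; [have := H ord0|have := H (lift ord0 i)]; rewrite ?tnth0 ?tnthS.
by case: (unliftP ord0 i) => [j|] -> /=; rewrite ?tnth0 ?tnthS//; exact: H.
Qed.

Lemma centered_itvE {R : realType} (a r : R) :
  ([set x | `|a - x| < r] : set (measurableTypeR R)) = `]a - r, a + r[%classic.
Proof.
have E (z : R) : `|a - z| < r <-> a - r < z < a + r.
  by rewrite ltr_norml; split=> /andP[? ?]; apply/andP; split; lra.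
by apply/seteqP; split => y /=; rewrite in_itv/= => /E.
Qed.

Lemma interval_measure {R : realType} (a r : R) : 0 <= r ->
  lebesgue_measure ([set x | `|a - x| < r] : set (measurableTypeR R)) = (2 * r)%:E.
Proof.
move=> r0; rewrite centered_itvE lebesgue_measure_itv/= lte_fin.
case: (ltP (a - r) (a + r)) => H; first by rewrite -EFinB; congr EFin; ring.
have r0E : r = 0 by lra.
by rewrite r0E mulr0.
Qed.

Lemma measurable_interval {R : realType} (a r : R) :
  measurable ([set x | `|a - x| < r] : set (measurableTypeR R)).
Proof. by rewrite centered_itvE. Qed.

Lemma tuple_box_measure {R : realType} {n : nat} (a : 'I_n -> R) (r : R) : 0 <= r ->
  lebesgue_tuple R n (tuple_box a r) = ((2 * r) ^+ n)%:E.
Proof.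
move=> r0; elim: n a => [|n IH] a.
  rewrite expr0 /= diracE mem_set//; by case.
rewrite -[LHS]/((lebesgue_measure \x lebesgue_tuple R n)%E
  (@tuple_cons _ (measurableTypeR R) n @^-1` tuple_box a r)).
rewrite (_ : _ @^-1` _ = [set x | `|a ord0 - x| < r] `*`
    tuple_box (a \o lift ord0) r); last first.
  by apply/seteqP; split => -[x t] /tuple_box_cons.
rewrite product_measure1E.
- by rewrite IH exprS EFinM; congr (_ * _)%E; exact: interval_measure.
- exact: measurable_interval.
- exact: measurable_tuple_box.
Qed.

Definition slab {R : realType} {n : nat} (l : 'I_n -> R) (c h : R) :
  set (n.-tuple (measurableTypeR R)) := [set t | `|\sum_i l i * tnth t i - c| <= h].

Lemma measurable_slab {R : realType} {n : nat} (l : 'I_n -> R) (c h : R) :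
  measurable (slab l c h).
Proof.
have mf : measurable_fun setT
    (fun t : n.-tuple (measurableTypeR R) => `|\sum_i l i * tnth t i - c| <= h).
  apply: measurable_fun_ler => //.
  apply: measurableT_comp => //; apply: measurable_funB => //.
  by apply: measurable_sum => i; apply: measurable_funM => //; exact: measurable_tnth.
by rewrite -[X in measurable X]setTI; exact: (mf _ [set true]).
Qed.

Lemma slab_cons {R : realType} {n : nat} (l : 'I_n.+1 -> R) (c h : R) x t :
  slab l c h (tuple_cons (x, t)) <->
  `|l ord0 * x + (\sum_i l (lift ord0 i) * tnth t i) - c| <= h.
Proof.
rewrite /slab/= big_ord_recl tnth0.
rewrite (eq_bigr (fun i => l (lift ord0 i) * tnth t i))// => i _.
by rewrite (tnthS x t).
Qed.

(* Slicing along the coordinate [j] makes each slice an interval of length at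
   most [2 * h / `|l j|], so that no rotation of the slab is needed. *)
Lemma slab_box_measure_le {R : realType} {n : nat} (a l : 'I_n -> R) (r c h : R)
    (j : 'I_n) : 0 <= r -> 0 <= h -> l j != 0 ->
  (lebesgue_tuple R n (tuple_box a r `&` slab l c h) <=
   ((2 * r) ^+ n.-1 * (2 * h / `|l j|))%:E)%E.
Proof.
move=> r0 h0; elim: n a l c j => [|n IH] a l c j lj; first by case: j lj.
rewrite -[X in (X <= _)%E]/((lebesgue_measure \x lebesgue_tuple R n)%E
  (@tuple_cons _ (measurableTypeR R) n @^-1` (tuple_box a r `&` slab l c h))).
set X := _ @^-1` _.
have mX : measurable X.
  rewrite -[X]setTI; apply: (@measurable_tuple_cons _ (measurableTypeR R) n) => //.
  by apply: measurableI; [exact: measurable_tuple_box|exact: measurable_slab].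
have v0 : 0 <= 2 * h / `|l j| by rewrite divr_ge0// mulr_ge0.
(* If [j] lies in the tail, fix the head [x]: the section is in a slab of one dimension less,
   recentred at [c - l ord0 * x], and induction applies. If [j] is the head, fix the tail
   instead. *)
move: lj v0; case: (unliftP ord0 j) => [j'|] -> lj v0.
  have n0 : (0 < n)%N by apply: leq_ltn_trans (ltn_ord j').
  apply: le_trans.
    apply: (@product_measure1_le _ _ _ _ R _ _ X [set x | `|a ord0 - x| < r]
      ((2 * r) ^+ n.-1 * (2 * h / `|l (lift ord0 j')|))) => //.
    - exact: measurable_interval.
    - by rewrite mulr_ge0// exprn_ge0// mulr_ge0.
    - by move=> [x t] [/tuple_box_cons[]].
    - move=> x _; apply: le_trans (IH (a \o lift ord0) (l \o lift ord0) (c - l ord0 * x) j' lj).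
      apply: le_measure; rewrite ?inE.
      + exact: measurable_xsection.
      + by apply: measurableI; [exact: measurable_tuple_box|exact: measurable_slab].
      + move=> t; rewrite /xsection/= inE => -[/tuple_box_cons[_ ?] /slab_cons H].
        split => //; rewrite /slab/=; apply: le_trans H.
        by rewrite le_eqVlt; apply/orP; left; apply/eqP; congr `|_|; ring.
  rewrite [X in (X * _)%E](_ : _ = (2 * r)%:E); last exact: interval_measure.
  by rewrite -EFinM lee_fin (mulrA (2 * r)) -exprS prednK.
apply: le_trans.
  apply: (@product_measure2_le _ _ _ _ R _ _ X (tuple_box (a \o lift ord0) r)
    (2 * (h / `|l ord0|))) => //.
  - exact: measurable_tuple_box.
  - by rewrite mulrA.
  - by move=> [x t] [/tuple_box_cons[]].
  - move=> t _.
    have lp : 0 < `|l ord0| by rewrite normr_gt0.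
    set b := (c - \sum_i l (lift ord0 i) * tnth t i) / l ord0.
    apply: (@le_trans _ _ (lebesgue_measure
      (`[b - h / `|l ord0|, b + h / `|l ord0|]%classic : set (measurableTypeR R)))).
      apply: le_measure; rewrite ?inE.
      + exact: measurable_ysection.
      + exact: measurable_itv.
      + move=> x; rewrite /ysection/= inE => -[_ /slab_cons H].
        rewrite in_itv/= -ler_distl ler_pdivlMr// -normrM; apply: le_trans H.
        rewrite le_eqVlt; apply/orP; left; apply/eqP; congr `|_|.
        by rewrite /b mulrBl divfK//; ring.
    rewrite lebesgue_measure_itv/= lte_fin; case: ifPn => // _.
      by rewrite -EFinB lee_fin; lra.
    by rewrite lee_fin mulr_ge0// divr_ge0.
rewrite tuple_box_measure//= -EFinM lee_fin mulrC.
by rewrite mulrA.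
Qed.

(** * Euclidean norm *)

(** Tuples carry the product sigma-algebra, so the open set is written as the countable union of the
    boxes with rational centre and radius [k.+1%:R^-1] that it contains. *)
Lemma measurable_row_of_open {R : realType} {n : nat} (U : set 'rV[R]_n) :
  open U -> measurable (@row_of R n @^-1` U : set (n.-tuple (measurableTypeR R))).
Proof.
move=> oU.
pose B (p : n.-tuple rat * nat) : set (n.-tuple (measurableTypeR R)) :=
  tuple_box (fun i => ratr (tnth p.1 i)) p.2.+1%:R^-1.
rewrite (_ : _ @^-1` U =
  \bigcup_(p : n.-tuple rat * nat)
    if `[< B p `<=` @row_of R n @^-1` U >] then B p else set0); last first.
  apply/seteqP; split=> t; last first.
    by move=> [p _]; case: asboolP => //; apply.
  move=> /= /oU /nbhs_ballP[e /= e0 eU].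
  (* Half of [e]: the rational centre is within one radius of [t], so every point of the box is
     within two radii. *)
  have [k _ ke] := near_infty_natSinv_lt (PosNum (divr_gt0 e0 (ltr0n _ 2))).
  have kp : 0 < k.+1%:R^-1 :> R by rewrite invr_gt0.
  have {}ke : k.+1%:R^-1 < e / 2 := ke k (leqnn k).
  have ratk i : {q : rat | `|ratr q - tnth t i| < k.+1%:R^-1}.
    apply: cid; have [|q] := @rat_in_itvoo R (tnth t i - k.+1%:R^-1) (tnth t i + k.+1%:R^-1).
      by rewrite ltrD2l gtrN.
    by rewrite in_itv/= -ltr_distl => ?; exists q.
  exists ([tuple sval (ratk i) | i < n], k) => //.
  have -> : `[< B ([tuple sval (ratk i) | i < n], k) `<=` @row_of R n @^-1` U >].
    apply/asboolP => t' Bt'; apply: eU; split => // i0 i; rewrite !mxE.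
    have := Bt' i; rewrite /= tnth_mktuple => h1.
    have := svalP (ratk i) => h2; rewrite /ball/=.
    rewrite (_ : tnth t i - tnth t' i = (ratr (sval (ratk i)) - tnth t' i) -
      (ratr (sval (ratk i)) - tnth t i)); last by ring.
    apply: le_lt_trans (ler_normB _ _) _; rewrite [ltRHS]splitr.
    exact: lt_trans (ltrD h1 h2) (ltrD ke ke).
  move=> i /=; rewrite tnth_mktuple; exact: svalP (ratk i).
apply: countable_bigcupT_measurable; first exact: countableP.
by move=> p; case: ifP => // _; exact: measurable_tuple_box.
Qed.

Section enorm_theory.
Context {R : realType} {n : nat}.
Implicit Types u v : 'rV[R]_n.

Lemma enorm_ge0 v : 0 <= enorm v.
Proof. exact: sqrtr_ge0. Qed.

Lemma sqr_enorm v : enorm v ^+ 2 = \sum_i v 0 i ^+ 2.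
Proof. by rewrite sqr_sqrtr// sumr_ge0// => i _; exact: sqr_ge0. Qed.

Lemma enormN v : enorm (- v) = enorm v.
Proof. by congr Num.sqrt; apply: eq_bigr => i _; rewrite mxE sqrrN. Qed.

Lemma enorm0 : enorm (0 : 'rV[R]_n) = 0.
Proof.
by rewrite /enorm big1 ?sqrtr0// => i _; rewrite mxE expr0n.
Qed.

Lemma ler_coord_enorm v i : `|v 0 i| <= enorm v.
Proof.
rewrite -sqrtr_sqr ler_sqrt ?sumr_ge0//; last by move=> j _; exact: sqr_ge0.
by rewrite (bigD1 i)//= lerDl sumr_ge0// => j _; exact: sqr_ge0.
Qed.

Lemma enorm_eq0 v : enorm v = 0 -> v = 0.
Proof.
move=> v0; apply/rowP => i; rewrite mxE; apply/eqP.
by rewrite -normr_le0 -v0; exact: ler_coord_enorm.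
Qed.

(** With [a] and [b] the two norms, each product [u_i v_i] is at most
    [u_i^2 b / (2a) + v_i^2 a / (2b)], and these bounds add up to [a b]. *)
Lemma enorm_cauchy u v : \sum_i u 0 i * v 0 i <= enorm u * enorm v.
Proof.
have [/enorm_eq0 ->|u0] := eqVneq (enorm u) 0.
  by rewrite enorm0 mul0r big1// => i _; rewrite mxE mul0r.
have [/enorm_eq0 ->|v0] := eqVneq (enorm v) 0.
  by rewrite enorm0 mulr0 big1// => i _; rewrite mxE mulr0.
have up : 0 < enorm u by rewrite lt_neqAle eq_sym u0 enorm_ge0.
have vp : 0 < enorm v by rewrite lt_neqAle eq_sym v0 enorm_ge0.
set a := enorm u; set b := enorm v.
apply: (@le_trans _ _ (\sum_i (u 0 i ^+ 2 * (b / a / 2) + v 0 i ^+ 2 * (a / b / 2)))).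
  apply: ler_sum => i _; rewrite -subr_ge0.
  rewrite (_ : _ - _ = (b * u 0 i - a * v 0 i) ^+ 2 / (2 * a * b)); last first.
    by field; apply/andP.
  by rewrite divr_ge0 ?sqr_ge0// !mulr_ge0// ltW.
rewrite big_split/= -!mulr_suml -!sqr_enorm -/a -/b le_eqVlt; apply/orP; left.
by apply/eqP; field; apply/andP.
Qed.

Lemma ler_enormD u v : enorm (u + v) <= enorm u + enorm v.
Proof.
rewrite -(@ler_pXn2r _ 2)// ?nnegrE ?addr_ge0 ?enorm_ge0// sqr_enorm.
have -> : \sum_i (u + v) 0 i ^+ 2 = \sum_i u 0 i ^+ 2 + 2 * (\sum_i u 0 i * v 0 i)
    + \sum_i v 0 i ^+ 2.
  by rewrite mulr_sumr -!big_split/=; apply: eq_bigr => i _; rewrite mxE; ring.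
by rewrite -!sqr_enorm; have := enorm_cauchy u v; nra.
Qed.

Lemma enormB u v : enorm (u - v) = enorm (v - u).
Proof. by rewrite -enormN opprB. Qed.

Lemma ler_enorm_sum v : enorm v <= \sum_i `|v 0 i|.
Proof.
rewrite -(@ler_pXn2r _ 2)// ?nnegrE ?enorm_ge0 ?sumr_ge0// sqr_enorm.
rewrite expr2 mulr_suml; apply: ler_sum => i _.
rewrite -real_normK ?num_real// expr2 ler_wpM2l//.
by rewrite (bigD1 i)//= lerDl sumr_ge0.
Qed.

(** The topology is that of the sup norm; this bound and [ler_coord_enorm] carry limits and
    neighbourhoods over to the Euclidean norm. *)
Lemma ler_enorm_norm v : enorm v <= n%:R * `|v|.
Proof.
apply: le_trans (ler_enorm_sum v) _.
rewrite -[X in X%:R]card_ord -sum1_card natr_sum mulr_suml; apply: ler_sum => i _.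
rewrite mul1r [leRHS]mx_normrE; apply: (le_trans _ (le_bigmax _ _ (0, i)))=> //.
Qed.

Lemma cvg_enormB {F : set_system nat} {FF : Filter F} (f : nat -> 'rV[R]_n)
    (x : 'rV[R]_n) : f @ F --> x -> enorm (f k - x) @[k --> F] --> 0.
Proof.
move=> fx; apply: (@squeeze_cvgr _ _ _ _ (cst 0) (fun k => n%:R * `|f k - x|)).
- by apply: nearW => k; rewrite enorm_ge0 ler_enorm_norm.
- exact: cvg_cst.
- rewrite -(mulr0 n%:R); apply: cvgM; first exact: cvg_cst.
  rewrite -(@normr0 _ 'rV[R]_n); apply: cvg_norm.
  by rewrite -(subrr x); apply: cvgB => //; exact: cvg_cst.
Qed.

Lemma measurable_enorm x :
  measurable_fun setT (fun t : n.-tuple (measurableTypeR R) => enorm (x - row_of t)).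
Proof.
apply: measurableT_comp.
  by apply: continuous_measurable_fun => y; exact: sqrt_continuous.
apply: measurable_sum => i; apply: measurable_funX.
rewrite (_ : (fun _ => _) = (fun t => x 0 i - tnth t i)).
  by apply: measurable_funB => //; exact: measurable_tnth.
by apply/funext => t; rewrite !mxE.
Qed.

End enorm_theory.

(** The function is dominated by the series of [a j] times the indicator of [A j], integrated term
    by term. It serves twice: for the decay of the kernel at infinity and for its singularity at
    [x]. *)
Lemma integral_le_geometric d (T : measurableType d) (R : realType)
    (mu : {measure set T -> \bar R}) (f : T -> \bar R) (a : R ^nat)
    (A : (set T)^nat) (c q : R) :
  measurable_fun setT f -> (forall t, (0 <= f t)%E) ->
  (forall j, measurable (A j)) -> (forall j, 0 <= a j) -> 0 <= c -> 0 <= q < 1 ->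
  (forall t, (0 < f t)%E -> exists j, A j t /\ (f t <= (a j)%:E)%E) ->
  (forall j, ((a j)%:E * mu (A j) <= (c * q ^+ j)%:E)%E) ->
  (\int[mu]_t f t <= (c / (1 - q))%:E)%E.
Proof.
move=> mf f0 mA a0 c0 /andP[q0 q1] fA aA.
apply: (@le_trans _ _ (\int[mu]_t (\sum_(j <oo) ((a j)%:E * (\1_(A j) t)%:E)))%E).
  apply: ge0_le_integral => //.
  - apply: (@ge0_emeasurable_sum _ _ _ _ (fun j t => ((a j)%:E * (\1_(A j) t)%:E)%E) xpredT).
      by move=> j t _ _; rewrite -EFinM lee_fin mulr_ge0.
    move=> j _; apply: measurable_funeM; apply/measurable_EFinP.
    exact: measurable_indic.
  - move=> t _; have [ft|ft] := ltP 0%E (f t); last first.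
      apply: le_trans ft _; apply: nneseries_ge0 => j _ _.
      by rewrite -EFinM lee_fin mulr_ge0.
    have [j [Aj faj]] := fA t ft; apply: (le_trans faj).
    rewrite (@nneseriesD1 _ _ j)//=; last by move=> k _; rewrite -EFinM lee_fin mulr_ge0.
    rewrite indicE mem_set// mule1 leeDl// nneseries_ge0// => k _ _.
    by rewrite -EFinM lee_fin mulr_ge0.
rewrite integral_nneseries//; last 2 first.
- move=> j; apply: measurable_funeM; apply/measurable_EFinP.
  exact: measurable_indic.
- by move=> j t _; rewrite -EFinM lee_fin mulr_ge0.
have E j : (\int[mu]_t ((a j)%:E * (\1_(A j) t)%:E) = (a j)%:E * mu (A j))%E.
  rewrite ge0_integralZl//; last by rewrite lee_fin.
  - by rewrite integral_indic ?setIT.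
  - by apply/measurable_EFinP; exact: measurable_indic.
under eq_eseriesr do rewrite E.
apply: lime_le.
  by apply: is_cvg_nneseries => j _ _; rewrite mule_ge0// lee_fin.
apply: nearW => m.
apply: (@le_trans _ _ (\sum_(0 <= j < m) (c * q ^+ j)%:E)%E).
  exact: lee_sum.
rewrite sumEFin lee_fin.
have := @geometric_seriesE R c q (negbT (lt_eqF q1)) => /(congr1 (fun f => f m)).
rewrite /series/geometric/= => ->.
by rewrite ler_pM2r ?invr_gt0 ?subr_gt0// ler_piMr// gerBl exprn_ge0.
Qed.

(** * Bounded kernels *)

Lemma powRX {R : realType} (r p : R) (j : nat) : 0 <= r -> (r ^+ j) `^ p = (r `^ p) ^+ j.
Proof. by move=> r0; rewrite -powR_mulrn// powRAC powR_mulrn// powR_ge0. Qed.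

Lemma dyadic_up {R : realType} (y : R) : 1 <= y ->
  exists j, (2 ^+ j) / 2 <= y < 2 ^+ j.
Proof.
move=> y1.
have ex : exists j, y < 2 ^+ j.
  exists (Num.trunc y).+1.
  have /andP[_ h] := truncn_itv (le_trans ler01 y1).
  by apply: (lt_trans h); rewrite -natrX ltr_nat ltn_expl.
case: (ex_minnP ex) => j yj minj; exists j; rewrite yj andbT.
case: j yj minj => [|j] yj minj; first by rewrite expr0 in yj; lra.
rewrite exprSr mulfK// leNgt; apply/negP => /minj; by rewrite ltnn.
Qed.

(** Applying [dyadic_up] to the inverse shows that some exponent satisfies the lower bound; the
    upper bound is the minimality of the least such exponent. *)
Lemma dyadic_down {R : realType} (y : R) : 0 < y < 1 ->
  exists j, (2^-1 ^+ j) / 2 <= y < 2^-1 ^+ j.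
Proof.
move=> /andP[y0 y1].
have iy1 : 1 <= y^-1 by rewrite invf_ge1// ltW.
have [[|j] /andP[h1 h2]] := dyadic_up _ iy1.
  by rewrite expr0 in h2; lra.
have p2 k : 0 < (2 : R) ^+ k by rewrite exprn_gt0.
have : exists k, (2^-1 ^+ k) / 2 <= y.
  exists j.+1; apply: (@le_trans _ _ (2^-1 ^+ j.+1)).
    by rewrite ler_pdivrMr// ler_peMr// ?exprn_ge0//; lra.
  by rewrite exprVn -[leRHS]invrK lef_pV2 ?posrE ?invr_gt0// ltW.
move=> ex; case: (ex_minnP ex) => k yk mink; exists k; rewrite yk/=.
case: k yk mink => [|k] yk mink; first by rewrite expr0.
rewrite ltNge exprSr; apply/negP => /mink; by rewrite ltnn.
Qed.

Section truncated_kernel.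
Context {R : realType} {n : nat}.
Local Notation T := (n.-tuple (measurableTypeR R)).
Local Notation mu := (lebesgue_tuple R n).
Implicit Types (x : 'rV[R]_n) (d p : R).

Definition capped_kernel p d x (t : T) : R := (Num.max (enorm (x - row_of t)) d `^ p)^-1.

Lemma measurable_capped_kernel p d x : measurable_fun setT (capped_kernel p d x).
Proof.
rewrite (_ : capped_kernel p d x =
    (@powR R ^~ (- p)) \o (fun t => Num.max (enorm (x - row_of t)) d)); last first.
  by apply/funext => t; rewrite /= powRN.
apply: measurableT_comp; first exact: measurable_powR.
by apply: measurable_maxr => //; exact: measurable_enorm.
Qed.

Lemma capped_kernel_gt0 p d x t : 0 < d -> 0 < capped_kernel p d x t.
Proof. by move=> d0; rewrite invr_gt0 powR_gt0// lt_max d0 orbT. Qed.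

Lemma capped_kernel_le p d x t : 0 < d -> 0 <= p -> capped_kernel p d x t <= (d `^ p)^-1.
Proof.
move=> d0 p0; rewrite lef_pV2 ?posrE ?powR_gt0// ?lt_max ?d0 ?orbT//.
apply: ge0_ler_powR; rewrite ?nnegrE ?le_max ?lexx ?(ltW d0) ?orbT//.
Qed.

Lemma in_tuple_box x r t : enorm (x - row_of t) < r -> tuple_box (x 0) r t.
Proof.
move=> h i; apply: le_lt_trans h; apply: le_trans (ler_coord_enorm _ i).
by rewrite !mxE.
Qed.

(** Dyadic shells going outwards: at scale [2^j d] the kernel is at most [(2^j d / 2)^(-p)] and the
    box has volume [(2^(j+1) d)^n], so the terms decay like [2^(-s j)]. The ball of radius [d] falls
    into one of these shells, since the capped distance is at least [d]. *)
Lemma integrable_capped_kernel s d x : 0 < s -> 0 < d ->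
  mu.-integrable setT (EFin \o capped_kernel (n%:R + s) d x).
Proof.
move=> s0 d0; set p := n%:R + s.
have p0 : 0 < p by rewrite ltr_wpDl.
apply/integrableP; split; first by apply/measurable_EFinP; exact: measurable_capped_kernel.
apply: (@le_lt_trans _ _
  ((((d / 2) `^ p)^-1 * (2 * d) ^+ n) / (1 - 2 `^ (- s)))%:E)%E; last exact: ltry.
have q1 : 2 `^ (- s) < 1 :> R.
  rewrite powRN invf_lt1 ?powR_gt0//.
  have := @gt0_ltr_powR R s s0 1 2; rewrite powR1 !nnegrE; apply; lra.
apply: (@integral_le_geometric _ _ R mu _
    (fun j => ((2 ^+ j * (d / 2)) `^ p)^-1) (fun j => tuple_box (x 0) (2 ^+ j * d))).
- by apply: measurableT_comp => //; apply/measurable_EFinP; exact: measurable_capped_kernel.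
- by [].
- by move=> j; exact: measurable_tuple_box.
- by move=> j; rewrite invr_ge0 powR_ge0.
- by rewrite mulr_ge0 ?invr_ge0 ?powR_ge0// exprn_ge0// mulr_ge0// ltW.
- by rewrite powR_ge0.
- move=> t _; set z := Num.max (enorm (x - row_of t)) d.
  have zd : d <= z by rewrite le_max lexx orbT.
  have [j /andP[h1 h2]] : exists j, 2 ^+ j / 2 <= z / d < 2 ^+ j.
    by apply: dyadic_up; rewrite ler_pdivlMr// mul1r.
  exists j; split.
    apply: in_tuple_box; apply: (@le_lt_trans _ _ z); first by rewrite le_max lexx.
    by rewrite -ltr_pdivrMr.
  rewrite /= lee_fin ger0_norm; last by rewrite ltW// capped_kernel_gt0.
  rewrite lef_pV2 ?posrE ?powR_gt0//; last 2 first.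
    by rewrite (lt_le_trans d0).
    by rewrite mulr_gt0 ?exprn_gt0// divr_gt0.
  apply: ge0_ler_powR; rewrite ?nnegrE ?(ltW p0)//.
  - by rewrite mulr_ge0 ?exprn_ge0// divr_ge0// ltW.
  - by rewrite (le_trans (ltW d0)).
  - by rewrite mulrCA mulrC -ler_pdivlMr.
- move=> j; rewrite [X in (_ * X)%E](@tuple_box_measure R n (x 0) (2 ^+ j * d)); last first.
    by rewrite mulr_ge0 ?exprn_ge0 ?(ltW d0).
  rewrite -EFinM lee_fin powRM ?exprn_ge0 ?divr_ge0 ?(ltW d0)//.
  rewrite mulrCA exprMn powRX// -exprM mulnC exprM invfM.
  rewrite (_ : 2 `^ (- s) = (2 `^ p)^-1 * 2 ^+ n); last first.
    by rewrite -powRN -powR_mulrn// -powRD ?pnatr_eq0 ?implybT// /p; congr powR; ring.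
  rewrite [(_^-1 * _) ^+ j]exprMn exprVn le_eqVlt; apply/orP; left; apply/eqP.
  by ring.
Qed.

End truncated_kernel.

(** * Symmetrisation of integrals about a point *)

Section symmetrisation.
Context {R : realType} {n : nat}.
Local Notation T := (n.-tuple (measurableTypeR R)).
Local Notation mu := (lebesgue_tuple R n).
Implicit Types (E : set 'rV[R]_n) (x : 'rV[R]_n) (d p : R).

Definition sgn_set E (y : 'rV[R]_n) : R := \1_E y - \1_(~` E) y.

Lemma sgn_setE E y : sgn_set E y = if y \in E then 1 else -1.
Proof. by rewrite /sgn_set !indicE in_setC; case: (y \in E); rewrite /=; lra. Qed.

Lemma norm_sgn_set E y : `|sgn_set E y| = 1.
Proof. by rewrite sgn_setE; case: ifP; rewrite ?normrN normr1. Qed.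

Lemma measurable_sgn_set E : open E ->
  measurable_fun setT (fun t : T => sgn_set E (row_of t)).
Proof.
move=> oE; have mE := measurable_row_of_open _ oE.
rewrite (_ : (fun t => _) =
  fun t : T => \1_(@row_of R n @^-1` E) t - \1_(~` (@row_of R n @^-1` E)) t)//.
by apply: measurable_funB; apply: measurable_indic => //; exact: measurableC.
Qed.

Lemma integrable_boundedM (g k : T -> R) :
  measurable_fun setT g -> (forall t, `|g t| <= 1) ->
  mu.-integrable setT (EFin \o k) ->
  mu.-integrable setT (EFin \o (fun t => g t * k t)).
Proof.
move=> mg g1 ik; have /integrableP[/measurable_EFinP mk _] := ik.
apply: le_integrable ik => //.
  by apply/measurable_EFinP; exact: measurable_funM.
by move=> t _; rewrite /= lee_fin normrM ler_piMl.
Qed.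

Definition center_tuple x : n.-tuple R := [tuple 2 * x 0 i | i < n].

Lemma row_of_reflect x (t : T) :
  row_of (reflect_tuple (center_tuple x) t) = 2 *: x - row_of t.
Proof. by apply/rowP => i; rewrite !mxE tnth_reflect_tuple tnth_mktuple. Qed.

Lemma Rintegral_reflect (c : n.-tuple R) (f : T -> R) :
  mu.-integrable setT (EFin \o f) ->
  mu.-integrable setT (EFin \o (f \o reflect_tuple c)) ->
  \int[mu]_t f t = \int[mu]_t f (reflect_tuple c t).
Proof.
move=> /integrableP[mf _] ifr; congr fine.
rewrite -[RHS](@integral_pushforward _ _ T T R (reflect_tuple c)
  (measurable_reflect_tuple c) mu setT (EFin \o f))//.
apply: eq_measure_integral; first exact: measurable_reflect_tuple.
by move=> ? A mA _; exact: (esym (lebesgue_tuple_reflect c A mA)).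
Qed.

(** Against a kernel even about [x], only the even part of [g] is seen. When [g] is the sign of a
    set, this removes every point whose mirror image lies on the other side. *)
Lemma symmetrised_integral x (g k : T -> R) :
  let r := @reflect_tuple R n (center_tuple x) in
  measurable_fun setT g -> (forall t, `|g t| <= 1) ->
  mu.-integrable setT (EFin \o k) -> (forall t, k (r t) = k t) ->
  \int[mu]_t (g t * k t) = \int[mu]_t ((g t + g (r t)) / 2 * k t).
Proof.
move=> r mg g1 ik kr.
have mgr : measurable_fun setT (g \o r).
  by apply: measurableT_comp => //; exact: measurable_reflect_tuple.
have igk := integrable_boundedM _ _ mg g1 ik.
have igrk : mu.-integrable setT (EFin \o (fun t => g (r t) * k t)).
  by apply: (integrable_boundedM (g \o r)) => // t; exact: g1.
have H : \int[mu]_t (g t * k t) = \int[mu]_t (g (r t) * k t).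
  rewrite (@Rintegral_reflect (center_tuple x) _ igk); last first.
    by move: igrk; congr (integrable _ _); apply/funext => t /=; rewrite kr.
  by apply: eq_Rintegral => t _; rewrite /= kr.
rewrite (_ : (fun t => _ / 2 * _) =
    (fun t => 2^-1 * (g t * k t + g (r t) * k t))); last first.
  by apply/funext => t; ring.
rewrite RintegralZl//; last first.
  by move: (integrableD measurableT igk igrk); congr (integrable _ _).
by rewrite RintegralD// -H; lra.
Qed.

Lemma enorm_center x (t : T) :
  enorm (x - row_of (reflect_tuple (center_tuple x) t)) = enorm (x - row_of t).
Proof.
by rewrite row_of_reflect enormB; congr enorm; apply/rowP => i; rewrite !mxE; ring.
Qed.

End symmetrisation.

(** * Difference of the truncated and the regularised curvature *)

Section truncation_estimate.
Context {R : realType} {n : nat}.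
Local Notation T := (n.-tuple (measurableTypeR R)).
Local Notation mu := (lebesgue_tuple R n).
Implicit Types (E : set 'rV[R]_n) (x : 'rV[R]_n) (d p : R).

(* The integral under the limit in [frac_mean_curv]. *)
Definition truncated_curv (s : R) E x (rho : R) : R :=
  \int[mu]_(t in [set t | rho <= enorm (x - row_of t)])
    (sgn_set E (row_of t) / enorm (x - row_of t) `^ (n%:R + s)).

Definition regularised_curv (s : R) E x d : R :=
  \int[mu]_t (sgn_set E (row_of t) * capped_kernel (n%:R + s) d x t).

(** Where the indicator is one, the cap [rho] is inactive and the first term is the truncated
    singular kernel; elsewhere it keeps the expression bounded. For [rho < d] the difference
    vanishes at distance [d] or more from [x]. *)
Definition shell_kernel p (rho d : R) x (t : T) : R :=
  \1_[set t | rho <= enorm (x - row_of t)] t * capped_kernel p rho x t - capped_kernel p d x t.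

Lemma measurable_far (rho : R) x :
  measurable ([set t | rho <= enorm (x - row_of t)] : set T).
Proof.
have mf : measurable_fun setT (fun t : T => rho <= enorm (x - row_of t)).
  by apply: measurable_fun_ler => //; exact: measurable_enorm.
by rewrite -[X in measurable X]setTI; exact: (mf _ [set true]).
Qed.

Lemma integrable_far s rho x : 0 < s -> 0 < rho ->
  mu.-integrable setT (EFin \o (fun t =>
    \1_[set t | rho <= enorm (x - row_of t)] t * capped_kernel (n%:R + s) rho x t)).
Proof.
move=> s0 r0; apply: integrable_boundedM; last exact: integrable_capped_kernel.
  by apply: measurable_indic; exact: measurable_far.
by move=> t; rewrite indicE; case: (_ \in _); rewrite ?normr1 ?normr0.
Qed.

Lemma integrable_shell_kernel s rho d x : 0 < s -> 0 < rho -> 0 < d ->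
  mu.-integrable setT (EFin \o shell_kernel (n%:R + s) rho d x).
Proof.
move=> s0 r0 d0.
have := integrableB measurableT (integrable_far _ _ x s0 r0)
  (integrable_capped_kernel _ _ x s0 d0).
by congr (integrable _ _).
Qed.

Lemma truncated_curvB s E x rho d : open E -> 0 < s -> 0 < rho -> 0 < d ->
  truncated_curv s E x rho - regularised_curv s E x d =
  \int[mu]_t (sgn_set E (row_of t) * shell_kernel (n%:R + s) rho d x t).
Proof.
move=> oE s0 r0 d0; rewrite /truncated_curv Rintegral_mkcond.
rewrite (_ : _ \_ _ = fun t => sgn_set E (row_of t) *
  (\1_[set t | rho <= enorm (x - row_of t)] t * capped_kernel (n%:R + s) rho x t)); last first.
  apply/funext => t; rewrite patchE indicE; case: ifPn => [|_].
    by rewrite inE /= mul1r /capped_kernel => /max_idPl ->.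
  by rewrite mul0r mulr0.
have ms := measurable_sgn_set _ oE.
have s1 t : `|sgn_set E (row_of t)| <= 1 by rewrite norm_sgn_set.
rewrite -RintegralB//; last 2 first.
- by apply: integrable_boundedM => //; exact: integrable_far.
- by apply: integrable_boundedM => //; exact: integrable_capped_kernel.
by apply: eq_Rintegral => t _; rewrite mulrBr.
Qed.

(* Points closer to [x] than [rho], including [x] itself, are put in the outermost
   shell [j = 0]: there the kernel is the constant [- d `^ - p]. *)
Lemma shell_kernel_bound p rho d x t : 0 < p -> 0 < rho < d ->
  shell_kernel p rho d x t != 0 -> exists j,
  enorm (x - row_of t) < 2^-1 ^+ j * d /\
  `|shell_kernel p rho d x t| <= ((2^-1 ^+ j * (d / 2)) `^ p)^-1.
Proof.
move=> p0 /andP[r0 rd]; rewrite /shell_kernel indicE /capped_kernel.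
set z := enorm _; have d0 := lt_trans r0 rd.
have [dz|zd] := leP d z.
  rewrite (_ : _ \in _) ?inE/=; last by rewrite (le_trans (ltW rd)).
  by rewrite max_l ?(le_trans (ltW rd))// mul1r subrr eqxx.
have [rz|zr] := leP rho z; last first.
  move=> _; exists 0%N; rewrite expr0 mul1r; split => //.
  rewrite (_ : (_ \in _) = false); last first.
    by apply/negbTE; rewrite notin_setE/= -/z; apply/negP; rewrite -ltNge.
  rewrite mul0r sub0r normrN mul1r ger0_norm ?invr_ge0 ?powR_ge0//.
  rewrite lef_pV2 ?posrE ?powR_gt0 ?divr_gt0//.
  by apply: ge0_ler_powR; rewrite ?nnegrE ?(ltW p0) ?(ltW d0) ?divr_ge0 ?(ltW d0)//; lra.
have z0 : 0 < z := lt_le_trans r0 rz.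
have -> : t \in [set t | rho <= enorm (x - row_of t)] by rewrite inE.
rewrite mul1r => _.
have [j /andP[h1 h2]] : exists j, 2^-1 ^+ j / 2 <= z / d < 2^-1 ^+ j.
  by apply: dyadic_down; rewrite divr_gt0//= ltr_pdivrMr// mul1r.
exists j; split; first by rewrite -ltr_pdivrMr.
have le1 : (d `^ p)^-1 <= (z `^ p)^-1.
  rewrite lef_pV2 ?posrE ?powR_gt0//.
  by apply: ge0_ler_powR; rewrite ?nnegrE ?(ltW p0) ?(ltW d0) ?(ltW z0) ?(ltW zd).
rewrite ger0_norm ?subr_ge0//; apply: (@le_trans _ _ (z `^ p)^-1).
  by rewrite gerBl invr_ge0 powR_ge0.
have y0 : 0 < 2^-1 ^+ j * (d / 2) by rewrite mulr_gt0 ?exprn_gt0 ?divr_gt0.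
rewrite lef_pV2 ?posrE ?powR_gt0//.
apply: ge0_ler_powR; rewrite ?nnegrE ?(ltW p0) ?(ltW y0) ?(ltW z0)//.
by rewrite mulrCA mulrC -ler_pdivlMr.
Qed.

End truncation_estimate.

(** * Error of the regularisation *)

Section estimate.
Context {R : realType} {n : nat}.
Local Notation T := (n.-tuple (measurableTypeR R)).
Local Notation mu := (lebesgue_tuple R n).
Implicit Types (E : set 'rV[R]_n) (x : 'rV[R]_n).

(* Up to the scale [d0], the points where the contributions of [y] and [2x - y]
   do not cancel lie in slabs around a hyperplane through [x].  The bound [k] on
   some coefficient of the normal [l] makes the volume of these slabs uniform. *)
Definition flat_at (a M k d0 : R) E x := exists l : 'I_n -> R,
  (exists j, k <= `|l j|) /\
  forall y, enorm (x - y) < d0 -> sgn_set E y + sgn_set E (2 *: x - y) != 0 ->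
    `|\sum_i l i * y 0 i - \sum_i l i * x 0 i| <= M * enorm (x - y) `^ (1 + a).

(** The numerator bounds one shell: the kernel at half the radius, the cross-section of the box, the
    thickness of the slab. The denominator sums the shells, a geometric series of ratio
    [2^(s - a)]. *)
Definition flat_const (s a M k : R) : R :=
  (2 `^ (n%:R + s) * 2 ^+ n.-1 * (2 * M) / k) / (1 - 2^-1 `^ (a - s)).

(** The bound does not involve [rho], and so gives both the existence of the limit defining the
    curvature and the rate at which the regularisation approaches it. *)
Lemma shell_integral_le (s a M k d0 rho d : R) E x : open E -> 0 < s < a ->
  0 <= M -> 0 < k -> 0 < rho < d -> d <= d0 -> flat_at a M k d0 E x ->
  `|truncated_curv s E x rho - regularised_curv s E x d| <=
  flat_const s a M k * d `^ (a - s).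
Proof.
move=> oE /andP[s0 sa] M0 k0 /andP[r0 rd] dd0 [l [[j0 kl] flat]].
have d0' : 0 < d := lt_trans r0 rd.
have lj0 : 0 < `|l j0| by exact: lt_le_trans kl.
have n0 : (0 < n)%N by apply: leq_ltn_trans (ltn_ord j0).
set p := n%:R + s; have p0 : 0 < p by rewrite ltr_wpDl.
rewrite truncated_curvB//; set K := shell_kernel p rho d x.
have iK : mu.-integrable setT (EFin \o K) by exact: integrable_shell_kernel.
have ms := measurable_sgn_set _ oE.
have s1 t : `|sgn_set E (@row_of R n t)| <= 1 by rewrite norm_sgn_set.
have Kr t : K (reflect_tuple (center_tuple x) t) = K t.
  rewrite /K /shell_kernel /capped_kernel !indicE enorm_center.
  rewrite (_ : (reflect_tuple _ t \in _) = (t \in [set t | rho <= enorm (x - row_of t)]))//.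
  by apply/idP/idP; rewrite !inE /= enorm_center.
have := @symmetrised_integral R n x (fun t => sgn_set E (row_of t)) K ms s1 iK Kr.
move=> /= ->.
set S := fun t => (sgn_set E (row_of t) +
  sgn_set E (row_of (reflect_tuple (center_tuple x) t))) / 2.
have mS : measurable_fun setT (S : T -> R).
  apply: measurable_funM => //; apply: measurable_funD => //.
  apply: (@measurableT_comp _ _ _ _ _ _ (fun t : T => sgn_set E (row_of t))) => //.
  exact: measurable_reflect_tuple.
have S1 t : `|S t| <= 1.
  rewrite normrM normfV (ger0_norm (ltW (ltr0n _ 2))) ler_pdivrMr// mul1r.
  by apply: le_trans (ler_normD _ _) _; rewrite !norm_sgn_set.
have iSK := integrable_boundedM _ _ mS S1 iK.
have /integrableP[/measurable_EFinP mSK _] := iSK.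
rewrite -lee_fin EFin_normr_Rintegral//.
apply: (le_trans (le_abse_integral _ measurableT _)); first exact/measurable_EFinP.
have q1 : 2^-1 `^ (a - s) < 1 :> R.
  have := @gt0_ltr_powR R (a - s) _ 2^-1 1; rewrite powR1 !nnegrE; apply => //.
  - by rewrite subr_gt0.
  - by rewrite invf_lt1 ?ltr1n.
rewrite /flat_const -/p mulrAC.
(* Contribution of the shell of outer radius [z]: the exponents add up to
   [-(n + s) + (n - 1) + (1 + a) = a - s], and the coefficient of [l] is replaced by its lower bound
   [k]. *)
have KE z : 0 < z -> ((z / 2) `^ p)^-1 * ((2 * z) ^+ n.-1 *
    (2 * (M * z `^ (1 + a)) / `|l j0|)) <=
    2 `^ p * 2 ^+ n.-1 * (2 * M) / k * z `^ (a - s).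
  move=> z0; apply: (@le_trans _ _ (2 `^ p * 2 ^+ n.-1 * (2 * M) / `|l j0| * z `^ (a - s))).
    rewrite le_eqVlt; apply/orP; left; apply/eqP.
    have h2 : 2^-1 `^ p = (2 `^ p)^-1 :> R.
      by rewrite -powR_inv1// -powRrM mulN1r powRN.
    rewrite powRM ?invr_ge0 ?(ltW z0)// h2 invfM invrK.
    have -> : z `^ (a - s) = (z `^ p)^-1 * z ^+ n.-1 * z `^ (1 + a).
      rewrite -powRN -powR_mulrn ?(ltW z0)// -!powRD ?(gt_eqF z0) ?implybT//.
      congr (_ `^ _); rewrite /p -[in n%:R](prednK n0) -natr1; ring.
    by rewrite exprMn; ring.
  rewrite ler_wpM2r ?powR_ge0// ler_wpM2l ?lef_pV2//.
  by rewrite !mulr_ge0 ?powR_ge0 ?exprn_ge0.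
apply: (@integral_le_geometric _ _ R mu _
  (fun j => ((2^-1 ^+ j * (d / 2)) `^ p)^-1)
  (fun j => tuple_box (x 0) (2^-1 ^+ j * d) `&`
    slab l (\sum_i l i * x 0 i) (M * (2^-1 ^+ j * d) `^ (1 + a)))).
- by apply: measurableT_comp => //; exact/measurable_EFinP.
- by [].
- by move=> j; apply: measurableI; [exact: measurable_tuple_box|exact: measurable_slab].
- by move=> j; rewrite invr_ge0 powR_ge0.
- by rewrite !mulr_ge0 ?powR_ge0 ?exprn_ge0 ?invr_ge0 ?(ltW k0).
- by rewrite powR_ge0.
- move=> t; rewrite /= lte_fin normr_gt0 mulf_eq0 negb_or => /andP[St Kt].
  have [|//|j [jz jK]] := @shell_kernel_bound _ _ p rho d x t p0; first by rewrite r0.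
  have yd : 2^-1 ^+ j * d <= d.
    by rewrite ler_piMl ?(ltW d0')// exprn_ile1//; lra.
  exists j; split; last first.
    by rewrite lee_fin normrM; apply: le_trans jK; rewrite ler_piMl//; exact: (S1 t).
  split; first exact: in_tuple_box.
  (* A nonzero [S t] means that [t] and its mirror image are on the same side, so flatness applies;
     the width is then enlarged to the one at the outer radius of the shell. *)
  have := flat (row_of t); rewrite (lt_le_trans jz)// ?(le_trans yd)//.
  rewrite -row_of_reflect => /(_ isT) H.
  have {}H := H _; rewrite /slab/=.
  have -> : \sum_i l i * tnth t i = \sum_i l i * (row_of t) 0 i.
    by apply: eq_bigr => i _; rewrite mxE.
  apply: le_trans (H _) _.
    by apply: contra_neq St; rewrite /S => ->; rewrite mul0r.
  rewrite ler_wpM2l//; apply: ge0_ler_powR; rewrite ?nnegrE ?enorm_ge0 ?(ltW jz)//.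
    by rewrite addr_ge0// ltW// (lt_trans s0).
  by rewrite mulr_ge0 ?exprn_ge0 ?(ltW d0').
- move=> j; have y0 : 0 < 2^-1 ^+ j * d by rewrite mulr_gt0 ?exprn_gt0.
  apply: (@le_trans _ _ (((2^-1 ^+ j * (d / 2)) `^ p)^-1%:E *
    ((2 * (2^-1 ^+ j * d)) ^+ n.-1 *
    (2 * (M * (2^-1 ^+ j * d) `^ (1 + a)) / `|l j0|))%:E)%E).
    apply: lee_wpmul2l; first by rewrite lee_fin invr_ge0 powR_ge0.
    apply: slab_box_measure_le; first exact: ltW.
      by rewrite mulr_ge0 ?powR_ge0.
    by rewrite -normr_gt0.
  rewrite -EFinM lee_fin (mulrA _ d); apply: le_trans (KE _ y0) _.
  rewrite powRM ?exprn_ge0 ?(ltW d0')// powRX// le_eqVlt; apply/orP; left.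
  by apply/eqP; ring.
Qed.

End estimate.

(** * Passage to the limit *)

Section limits.
Context {R : realType} {n : nat}.
Local Notation T := (n.-tuple (measurableTypeR R)).
Local Notation mu := (lebesgue_tuple R n).
Implicit Types (E : set 'rV[R]_n) (x : 'rV[R]_n).

Lemma flat_const_ge0 (s a M k : R) : 0 < s < a -> 0 <= M -> 0 < k ->
  0 <= @flat_const R n s a M k.
Proof.
move=> /andP[s0 sa] M0 k0; rewrite /flat_const divr_ge0//.
  by rewrite divr_ge0 ?(ltW k0)// !mulr_ge0 ?powR_ge0 ?exprn_ge0.
rewrite subr_ge0 ltW//.
have := @gt0_ltr_powR R (a - s) _ 2^-1 1; rewrite powR1 !nnegrE; apply => //.
- by rewrite subr_gt0.
- by rewrite invf_lt1 ?ltr1n.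
Qed.

Lemma powR_small (c b e d0 : R) : 0 < b -> 0 < e -> 0 < d0 -> 0 <= c ->
  exists2 d, 0 < d <= d0 & c * d `^ b < e.
Proof.
move=> b0 e0 d00 c0.
have c1 : 0 < c + 1 by rewrite ltr_wpDl.
(* Solves [(c + 1) y^b = e]; adding one makes the final inequality strict and allows [c = 0]. *)
pose y := (e / (c + 1)) `^ b^-1.
have y0 : 0 < y by apply: powR_gt0; exact: divr_gt0.
exists (Num.min d0 y); first by rewrite lt_min d00 y0 ge_min lexx.
apply: (@le_lt_trans _ _ (c * y `^ b)).
  rewrite ler_wpM2l//; apply: ge0_ler_powR; rewrite ?nnegrE ?(ltW b0) ?(ltW y0)//.
    by rewrite le_min (ltW d00) (ltW y0).
  by rewrite ge_min lexx orbT.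
rewrite /y -powRrM mulVf ?gt_eqF// powRr1 ?divr_ge0 ?(ltW e0) ?(ltW c1)//.
by rewrite mulrCA gtr_pMr// ltr_pdivrMr// mul1r ltrDl.
Qed.

(** By the shell estimate, all truncations at small [rho] lie near one regularised value, which is
    the Cauchy criterion. The [lim] is thus a true limit, and the estimate passes to it. *)
Lemma frac_mean_curv_near (s a M k d0 : R) E x : open E -> 0 < s < a ->
  0 <= M -> 0 < k -> 0 < d0 -> flat_at a M k d0 E x -> forall d, 0 < d <= d0 ->
  `|frac_mean_curv s E x - regularised_curv s E x d| <=
  @flat_const R n s a M k * d `^ (a - s).
Proof.
move=> oE sa M0 k0 d00 flat d /andP[dp dd0].
have est := @shell_integral_le R n s a M k d0 _ _ E x oE sa M0 k0 _ _ flat.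
have C0 := @flat_const_ge0 s a M k sa M0 k0.
have as0 : 0 < a - s by rewrite subr_gt0; case/andP: sa.
have cv : cvg (truncated_curv s E x rho @[rho --> 0^'+]).
  apply: cauchy_cvg; apply: cauchy_exP => _/posnumP[e].
  have [d' /andP[d'0 d'd0] d'e] := @powR_small _ (a - s) e%:num d0 as0 (gt0 e) d00 C0.
  exists (regularised_curv s E x d').
  suff : \forall rho \near 0^'+, ball (regularised_curv s E x d') e%:num
    (truncated_curv s E x rho) by [].
  near=> rho; rewrite /ball/= distrC; apply: le_lt_trans d'e; apply: est => //.
  apply/andP; split; near: rho; first exact: nbhs_right_gt.
  exact: nbhs_right_lt.
have near_est : \forall rho \near 0^'+, 
    `|truncated_curv s E x rho - regularised_curv s E x d| <=
    @flat_const R n s a M k * d `^ (a - s).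
  near=> rho; apply: est => //.
  apply/andP; split; near: rho; first exact: nbhs_right_gt.
  exact: nbhs_right_lt.
have cv' : `|truncated_curv s E x rho - regularised_curv s E x d| @[rho --> 0^'+] -->
    `|frac_mean_curv s E x - regularised_curv s E x d|.
  by apply: cvg_norm; apply: cvgB; [exact: cv|exact: cvg_cst].
exact: (cvgr_to_le cv' near_est).
Unshelve. all: by end_near. Qed.

(** Moving the centre by [B] adds at most [B] to a capped distance that is at least [d], hence
    multiplies it by at most [1 + B / d]. This provides the dominating function for a bounded
    sequence of centres. *)
Lemma capped_kernel_scale (p d B : R) x y t : 0 < d -> 0 <= p -> enorm (x - y) <= B ->
  capped_kernel p d x t <= (1 + B / d) `^ p * capped_kernel p d y t.
Proof.
move=> d0 p0 xyB.
have B0 : 0 <= B by apply: le_trans xyB; exact: enorm_ge0.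
have e1 : 0 < 1 + B / d by rewrite ltr_pwDl// divr_ge0// ltW.
rewrite /capped_kernel; set u := Num.max _ _; set v := Num.max _ _.
have u0 : 0 < u by rewrite lt_max d0 orbT.
have v0 : 0 < v by rewrite lt_max d0 orbT.
have vu : v <= (1 + B / d) * u.
  have ud : d <= u by rewrite le_max lexx orbT.
  have ux : enorm (x - row_of t) <= u by rewrite le_max lexx.
  have Bu : B <= B / d * u by rewrite mulrAC ler_pdivlMr// ler_wpM2l.
  rewrite mulrDl mul1r ge_max; apply/andP; split; last first.
    by apply: (le_trans ud); rewrite lerDl (le_trans B0).
  rewrite (_ : y - row_of t = (x - row_of t) + (y - x)); last by rewrite [RHS]addrC subrKA.
  by apply: (le_trans (ler_enormD _ _)); rewrite lerD// (le_trans _ Bu)// enormB.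
have : v `^ p <= (1 + B / d) `^ p * u `^ p.
  rewrite -powRM ?(ltW e1) ?(ltW u0)//.
  by apply: ge0_ler_powR; rewrite ?nnegrE ?(ltW v0)// mulr_ge0 ?(ltW e1) ?(ltW u0).
have up : 0 < u `^ p by rewrite powR_gt0.
have vp : 0 < v `^ p by rewrite powR_gt0.
have aux (a b c : R) : 0 < a -> 0 < b -> b <= c * a -> a^-1 <= c / b.
  by move=> a0 b0 h; rewrite -[a^-1]mul1r ler_pdivrMr// mulrAC ler_pdivlMr// mul1r.
exact: aux.
Qed.

Lemma cvg_capped_kernel (p d : R) (x : 'rV[R]_n) (x_ : nat -> 'rV[R]_n) (t : T) : 0 < d ->
  x_ k @[k --> \oo] --> x ->
  capped_kernel p d (x_ k) t @[k --> \oo] --> capped_kernel p d x t.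
Proof.
move=> d0 xx.
have ce : enorm (x_ k - row_of t) @[k --> \oo] --> enorm (x - row_of t).
  apply/cvgrPdist_lt => e e0.
  have h : enorm (x_ k - x) @[k --> \oo] --> 0.
    exact: cvg_enormB.
  near=> k.
  apply: (@le_lt_trans _ _ `|enorm (x_ k - x)|); last first.
    by near: k; exact: (cvgr0_norm_lt _ h).
  rewrite [leRHS]ger0_norm ?enorm_ge0// ler_norml; apply/andP; split.
    have := ler_enormD (x_ k - x) (x - row_of t).
    rewrite subrKA; lra.
  have := ler_enormD (x - x_ k) (x_ k - row_of t).
  rewrite subrKA (enormB x (x_ k)); lra.
have cm : Num.max (enorm (x_ k - row_of t)) d @[k --> \oo] -->
    Num.max (enorm (x - row_of t)) d.
  apply: (@cvg_comp _ _ _ (fun k => enorm (x_ k - row_of t)) (Num.max^~ d) _ _ _ ce).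
  by apply: (@continuous_max _ _ id (cst d)); [exact: cvg_id|exact: cvg_cst].
have m0 : 0 < Num.max (enorm (x - row_of t)) d by rewrite lt_max d0 orbT.
have cpow : {for Num.max (enorm (x - row_of t)) d, continuous (@powR R ^~ p)}.
  apply: differentiable_continuous; apply/derivable1_diffP.
  by apply: derivable_powR; rewrite in_itv/= m0.
apply: cvgV; first by rewrite gt_eqF// powR_gt0.
apply: (@cvg_comp _ _ _ (fun k => Num.max (enorm (x_ k - row_of t)) d) (@powR R ^~ p) _ _ _ cm).
exact: cpow.
Unshelve. all: by end_near. Qed.

End limits.

Lemma dist_lt4 {R : realType} (f g u v e : R) : `|f - u| < e / 4 ->
  `|g - v| < e / 4 -> `|u - v| < e / 4 -> `|f - g| < e.
Proof.
rewrite !ltr_norml => /andP[? ?] /andP[? ?] /andP[? ?].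
by apply/andP; split; lra.
Qed.

(** * Continuity of the regularised curvature and of its limit *)

Section continuity.
Context {R : realType} {n : nat}.
Local Notation T := (n.-tuple (measurableTypeR R)).
Local Notation mu := (lebesgue_tuple R n).
Implicit Types (E : set 'rV[R]_n) (x : 'rV[R]_n).

Lemma cvg_integral_capped_kernel (s d : R) x (x_ : nat -> 'rV[R]_n) : 0 < s -> 0 < d ->
  x_ k @[k --> \oo] --> x ->
  (\int[mu]_t `|(capped_kernel (n%:R + s) d (x_ k) t - capped_kernel (n%:R + s) d x t)%:E|)%E
    @[k --> \oo] --> 0%E.
Proof.
move=> s0 d0 xx; set p := n%:R + s.
have p0 : 0 <= p by rewrite addr_ge0// ltW.
have ce : enorm (x_ k - x) @[k --> \oo] --> 0 by exact: cvg_enormB.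
(* One bound for all [k], since the dominating function may not depend on [k]. *)
have [B xB] : exists B, forall k, enorm (x_ k - x) <= B.
  have /cvg_seq_bounded : cvgn (fun k => enorm (x_ k - x)) by apply/cvg_ex; exists 0.
  move=> [M [_ MB]]; exists (M + 1) => k.
  apply: (le_trans (ler_norm _)); apply: MB => //; by rewrite ltrDl.
have mc y : measurable_fun setT (EFin \o @capped_kernel R n p d y).
  by apply/measurable_EFinP; exact: measurable_capped_kernel.
have [] := @dominated_convergence _ _ _ mu setT measurableT
  (fun k => EFin \o capped_kernel p d (x_ k)) (EFin \o capped_kernel p d x)
  (EFin \o (fun t => (1 + B / d) `^ p * capped_kernel p d x t)) (fun k => mc _) (mc _).
- apply: aeW => t _; apply: cvg_EFin; first exact: nearW.
  exact: cvg_capped_kernel.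
- by have := integrableZl measurableT ((1 + B / d) `^ p) (integrable_capped_kernel _ _ x s0 d0).
- apply: aeW => t k _; rewrite /= lee_fin ger0_norm; last by rewrite ltW// capped_kernel_gt0.
  by apply: capped_kernel_scale.
- by [].
Qed.

(** Change the set first, then the centre: the signs differ, by two, only on the symmetric
    difference, where the kernel is at most [d^(-p)]; what remains is the [L^1] distance of the two
    kernels. *)
Lemma regularised_curv_dist (s d : R) E x F y : open E -> open F -> 0 < s -> 0 < d ->
  (`|regularised_curv s E x d - regularised_curv s F y d|%:E <=
   (2 / d `^ (n%:R + s))%:E * volume (E `+` F) +
   \int[mu]_t `|(capped_kernel (n%:R + s) d x t - capped_kernel (n%:R + s) d y t)%:E|)%E.
Proof.
move=> oE oF s0 d0; set p := n%:R + s.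
have p0 : 0 <= p by rewrite addr_ge0// ltW.
have mE := measurable_row_of_open _ oE; have mF := measurable_row_of_open _ oF.
have iJ G z : open G -> mu.-integrable setT
    (EFin \o (fun t => sgn_set G (row_of t) * capped_kernel p d z t)).
  move=> oG; apply: integrable_boundedM; last exact: integrable_capped_kernel.
    exact: measurable_sgn_set.
  by move=> t; rewrite norm_sgn_set.
have mD : measurable (@row_of R n @^-1` (E `+` F) : set T).
  by apply: measurableU; exact: measurableD.
rewrite /regularised_curv -RintegralB//; [|exact: iJ..].
have ih := integrableB measurableT (iJ _ x oE) (iJ _ y oF).
rewrite EFin_normr_Rintegral//.
have /integrableP[mh _] := ih.
apply: (le_trans (le_abse_integral _ measurableT mh)).
have mcc : measurable_fun setT
    (fun t : T => `|(capped_kernel p d x t - capped_kernel p d y t)%:E|%E).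
  apply: measurableT_comp => //; apply/measurable_EFinP.
  by apply: measurable_funB; exact: measurable_capped_kernel.
have m1 : measurable_fun setT
  (fun t : T => (2 / d `^ p)%:E * (\1_(@row_of R n @^-1` (E `+` F)) t)%:E)%E.
  by apply: measurable_funeM; apply/measurable_EFinP; exact: measurable_indic.
apply: (@le_trans _ _ (\int[mu]_t ((2 / d `^ p)%:E *
  (\1_(@row_of R n @^-1` (E `+` F)) t)%:E + `|(capped_kernel p d x t - capped_kernel p d y t)%:E|))%E).
  apply: ge0_le_integral => //.
  - by apply: measurableT_comp.
  - by apply: emeasurable_funD.
  - move=> t _ /=; rewrite -EFinM -EFinD lee_fin.
    have cx : 0 < capped_kernel p d x t by exact: capped_kernel_gt0.
    have cxd : capped_kernel p d x t <= (d `^ p)^-1 by exact: capped_kernel_le.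
    have split_diff (a b c e : R) : a * c - b * e = (a - b) * c + b * (c - e) by ring.
    rewrite split_diff.
    apply: (le_trans (ler_normD _ _)); rewrite !normrM norm_sgn_set mul1r lerD2r.
    rewrite (gtr0_norm cx) !sgn_setE indicE.
    have [tE|tE] := boolP (row_of t \in E); have [tF|tF] := boolP (row_of t \in F).
    + by rewrite subrr normr0 mul0r mulr_ge0 ?divr_ge0 ?powR_ge0.
    + rewrite mem_set/= ?mulr1; last by left; split; [exact: set_mem|move: tF; rewrite notin_setE].
      by rewrite (_ : 1 - -1 = 2) ?normr_nat ?ler_wpM2l//; ring.
    + rewrite mem_set/= ?mulr1; last by right; split; [exact: set_mem|move: tE; rewrite notin_setE].
      by rewrite (_ : -1 - 1 = - 2) ?normrN ?normr_nat ?ler_wpM2l//; ring.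
    + by rewrite subrr normr0 mul0r mulr_ge0 ?divr_ge0 ?powR_ge0.
rewrite ge0_integralD//; last by move=> t _; rewrite -EFinM lee_fin mulr_ge0 ?divr_ge0 ?powR_ge0.
rewrite leeD2r// ge0_integralZl//; last 2 first.
- by apply/measurable_EFinP; exact: measurable_indic.
- by rewrite lee_fin divr_ge0 ?powR_ge0.
by rewrite integral_indic// setIT.
Qed.

Lemma regularised_curv_cvg (s d : R) E (E_ : nat -> set 'rV[R]_n) x
    (x_ : nat -> 'rV[R]_n) : open E -> (forall k, open (E_ k)) -> 0 < s -> 0 < d ->
  volume (E_ k `+` E) @[k --> \oo] --> 0%E -> x_ k @[k --> \oo] --> x ->
  regularised_curv s (E_ k) (x_ k) d @[k --> \oo] --> regularised_curv s E x d.
Proof.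
move=> oE oE_ s0 d0 EE xx.
have cv : ((2 / d `^ (n%:R + s))%:E * volume (E_ k `+` E) +
   \int[mu]_t `|(capped_kernel (n%:R + s) d (x_ k) t - capped_kernel (n%:R + s) d x t)%:E|)%E
   @[k --> \oo] --> 0%E.
  rewrite -(adde0 0%E); apply: cvgeD => //; last exact: cvg_integral_capped_kernel.
  by rewrite -(mule0 (2 / d `^ (n%:R + s))%:E); apply: cvgeZl.
apply/cvgrPdist_lt => e e0; near=> k.
rewrite distrC -lte_fin; apply: (le_lt_trans (regularised_curv_dist _ _ _ _ _ _ (oE_ k) oE s0 d0)).
near: k.
have : \forall y \near (0%E : \bar R), (y < e%:E)%E by exact: lt_nbhsl.
exact: cv.
Unshelve. all: by end_near. Qed.

(** First [d] is chosen to make the regularisation error small for the limit and for all large [k]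
    at once, as the flatness constants are shared; then [k] tends to infinity with [d] fixed. *)
Lemma frac_mean_curv_cvg (s a M k0 d0 : R) E (E_ : nat -> set 'rV[R]_n) x
    (x_ : nat -> 'rV[R]_n) : open E -> (forall k, open (E_ k)) -> 0 < s < a ->
  0 <= M -> 0 < k0 -> 0 < d0 -> flat_at a M k0 d0 E x ->
  (\forall k \near \oo, flat_at a M k0 d0 (E_ k) (x_ k)) ->
  volume (E_ k `+` E) @[k --> \oo] --> 0%E -> x_ k @[k --> \oo] --> x ->
  frac_mean_curv s (E_ k) (x_ k) @[k --> \oo] --> frac_mean_curv s E x.
Proof.
move=> oE oE_ sa M0 k00 d00 fE fE_ EE xx.
have C0 := @flat_const_ge0 R n s a M k0 sa M0 k00.
have s0 : 0 < s by case/andP: sa.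
have as0 : 0 < a - s by rewrite subr_gt0; case/andP: sa.
apply/cvgrPdist_lt => e e0.
have e4 : 0 < e / 4 by rewrite divr_gt0.
have [d dd0 de] := @powR_small R _ (a - s) (e / 4) d0 as0 e4 d00 C0.
have d1 : 0 < d by case/andP: dd0.
have h0 := @frac_mean_curv_near R n s a M k0 d0 E x oE sa M0 k00 d00 fE d dd0.
have cv := @regularised_curv_cvg s d E E_ x x_ oE oE_ s0 d1 EE xx.
near=> k.
have fk : flat_at a M k0 d0 (E_ k) (x_ k) by near: k.
have hk := @frac_mean_curv_near R n s a M k0 d0 _ _ (oE_ k) sa M0 k00 d00 fk d dd0.
have hc : `|regularised_curv s E x d - regularised_curv s (E_ k) (x_ k) d| < e / 4.
  by near: k; move/cvgrPdist_lt : cv; apply.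
move: h0 hk hc => /le_lt_trans/(_ de) h0 /le_lt_trans/(_ de) hk hc.
exact: dist_lt4 h0 hk hc.
Unshelve. all: by end_near. Qed.

End continuity.

(** * Taylor expansion of graphs *)

Section coordinatewise_mean_value.
Context {R : realType} {m : nat}.
Implicit Types (u : 'rV[R]_m -> R) (y z v : 'rV[R]_m).

Lemma is_derive_line u y v (t : R) : derivable u (t *: v + y) v ->
  is_derive t 1 (fun t : R => u (t *: v + y)) ('D_v u (t *: v + y)).
Proof.
have E : (fun h : R => h^-1 *: (((fun t : R => u (t *: v + y)) \o shift t) (h *: 1) -
      u (t *: v + y))) =
    (fun h : R => h^-1 *: ((u \o shift (t *: v + y)) (h *: v) - u (t *: v + y))).
  apply/funext => h /=; congr (_ *: (u _ - _)).
  by rewrite [h *: 1]mulr1 scalerDl addrA.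
by move=> du; split; rewrite ?/derivable ?/derive E.
Qed.

(** The hypothesis on the symmetric interval [|t| <= |c|] covers both signs of [c], as increments of
    a coordinate may be negative. *)
Lemma mean_value_line (f df : R -> R) (c : R) :
  (forall t : R, `|t| <= `|c| -> is_derive t 1 f (df t)) ->
  exists2 t, `|t| <= `|c| & f c - f 0 = df t * c.
Proof.
move=> dfE.
have cts a b : (forall t, a <= t <= b -> `|t| <= `|c|) ->
    {within `[a, b], continuous f}.
  move=> H; apply: derivable_within_continuous => t; rewrite in_itv/= => /H ct.
  by have [] := dfE t ct.
have [c0|c0] := leP 0 c.
  have cc t : 0 <= t <= c -> `|t| <= `|c| by move=> /andP[? ?]; rewrite !ger0_norm.
  have [t|t] := @MVT_segment R f df 0 c c0 _ (cts 0 c cc).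
    by rewrite in_itv/= => /andP[? ?]; apply: dfE; rewrite cc// !ltW.
  by rewrite in_itv/= => /cc tc ->; exists t => //; rewrite subr0.
have cc t : c <= t <= 0 -> `|t| <= `|c|.
  by move=> /andP[? ?]; rewrite !ler0_norm ?lerN2// ltW.
have [t|t] := @MVT_segment R f df c 0 (ltW c0) _ (cts c 0 cc).
  by rewrite in_itv/= => /andP[? ?]; apply: dfE; rewrite cc// !ltW.
rewrite in_itv/= => /cc tc E; exists t => //.
by rewrite -[LHS]opprB E sub0r mulrN opprK.
Qed.

Lemma ler_enorm_coord y z : (forall i, `|y 0 i| <= `|z 0 i|) -> enorm y <= enorm z.
Proof.
move=> yz; rewrite ler_sqrt ?sumr_ge0//; last by move=> i _; exact: sqr_ge0.
apply: ler_sum => i _; rewrite -(real_normK (num_real (y 0 i))).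
by rewrite -(real_normK (num_real (z 0 i))) lerXn2r ?nnegrE.
Qed.

(** Going from [y] to [y + z] one coordinate at a time uses partial derivatives only, with one
    intermediate point per coordinate, and never leaves the ball of radius [enorm z] about [y]. *)
Lemma coordinatewise_mean_value u y z :
  (forall i w, enorm (w - y) <= enorm z -> derivable u w (delta_mx 0 i)) ->
  exists xi : 'I_m -> 'rV[R]_m, (forall i, enorm (xi i - y) <= enorm z) /\
    u (y + z) - u y = \sum_i partial i u (xi i) * z 0 i.
Proof.
move=> du.
(* The point reached after the first [j] coordinates have been moved. *)
pose w (j : nat) : 'rV[R]_m := y + \row_i (if (i < j)%N then z 0 i else 0).
have step (j : 'I_m) : exists xi, enorm (xi - y) <= enorm z /\
    u (w j.+1) - u (w j) = partial j u xi * z 0 j.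
  pose e : 'rV[R]_m := delta_mx 0 j.
  have we t : `|t| <= `|z 0 j| -> enorm (t *: e + w j - y) <= enorm z.
    move=> tz; apply: ler_enorm_coord => i.
    rewrite /w !mxE eqxx/=; case: eqVneq => [->|ij].
      by rewrite ltnn addr0 addrK mulr1.
    rewrite mulr0 add0r addrAC subrr add0r; case: ifP => // _.
    by rewrite normr0.
  have [t tz E] := @mean_value_line (fun t : R => u (t *: e + w j))
    (fun t => 'D_e u (t *: e + w j)) (z 0 j)
    (fun t tz => @is_derive_line u (w j) e t (du _ _ (we t tz))).
  exists (t *: e + w j); split; first exact: we.
  rewrite /partial -/e -E scale0r add0r; congr (u _ - _).
  rewrite /w addrCA; congr (_ + _); apply/rowP => i; rewrite !mxE eqxx/=.
  rewrite ltnS leq_eqVlt; case: (eqVneq i j) => [->|ij].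
    by rewrite eqxx ltnn/= mulr1 addr0.
  by rewrite (_ : (i == j :> nat) = false) ?mulr0 ?add0r//; exact/negbTE.
exists (fun j => sval (cid (step j))); split.
  by move=> j; case: cid => xi [].
rewrite [RHS](eq_bigr (fun j : 'I_m => u (w j.+1) - u (w j))); last first.
  by move=> j _; case: cid => xi [].
rewrite -(big_mkord xpredT (fun j => u (w j.+1) - u (w j))) telescope_sumr//.
congr (u _ - u _); rewrite /w; apply/rowP => i; rewrite !mxE.
  by rewrite ltn_ord.
by rewrite addr0.
Qed.

End coordinatewise_mean_value.

Lemma nbhs_enormP {R : realType} {n : nat} (x : 'rV[R]_n) (A : set 'rV[R]_n) :
  nbhs x A <-> exists2 e, 0 < e & forall y, enorm (x - y) < e -> A y.
Proof.
split=> [/nbhs_ballP[e /= e0 eA]|[e e0 eA]].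
  exists e => // y xy; apply: eA; split => // i j; rewrite !ord1 /ball/=.
  by apply: le_lt_trans xy; rewrite -[_ - _](_ : (x - y) 0 j = _) ?ler_coord_enorm// !mxE.
apply/nbhs_ballP; exists (e / n.+1%:R); first by rewrite /= divr_gt0.
move=> y; rewrite mx_norm_ball /ball_/= => xy; apply: eA.
apply: (le_lt_trans (ler_enorm_norm _)).
rewrite ltr_pdivlMr// in xy; apply: le_lt_trans xy.
by rewrite mulrC ler_wpM2l// ler_nat.
Qed.

Section gradient.
Context {R : realType} {m : nat}.
Implicit Types (u : 'rV[R]_m -> R) (c y z : 'rV[R]_m).

(** The common form in which both kinds of convergence are used: exponent [a] in the Holder case,
    exponent 1 in the [C^2] case, on a fixed ball. *)
Definition holder_gradient (a M r : R) c u := forall y, enorm (y - c) < r ->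
  [/\ {for y, continuous u}, forall i, derivable u y (delta_mx 0 i) &
      forall y', enorm (y' - c) < r -> forall i,
        `|partial i u y - partial i u y'| <= M * enorm (y - y') `^ a].

(** The mean value points are within [enorm z] of [y], so replacing each partial derivative by its
    value at [y] costs [M |z|^a] per coordinate, multiplied by [|z_i|]. *)
Lemma holder_taylor (a M r : R) c u y z : 0 < a -> 0 <= M ->
  holder_gradient a M r c u -> enorm (y - c) + enorm z < r ->
  `|u (y + z) - u y - \sum_i partial i u y * z 0 i| <=
  m%:R * M * enorm z `^ (1 + a).
Proof.
move=> a0 M0 hu yzr.
have inr w : enorm (w - y) <= enorm z -> enorm (w - c) < r.
  move=> wz; rewrite -(subrKA y w (- c)); apply: le_lt_trans (ler_enormD _ _) _.
  by apply: le_lt_trans yzr; rewrite addrC lerD2l.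
have yr : enorm (y - c) < r by apply: inr; rewrite subrr enorm0 enorm_ge0.
have [i w wz|xi [xiz ->]] := @coordinatewise_mean_value R m u y z.
  by have [] := hu w (inr w wz).
rewrite -sumrB; apply: le_trans (ler_norm_sum _ _ _) _.
rewrite -mulrA -[X in X%:R]card_ord -sum1_card natr_sum mulr_suml.
apply: ler_sum => i _; rewrite mul1r -mulrBl normrM.
have [_ _ hi] := hu _ (inr _ (xiz i)).
rewrite -(@mulr_powRB1 _ _ (1 + a)) ?enorm_ge0 ?addr_gt0// (addrC 1) addrK.
rewrite (mulrC (enorm z)) mulrA ler_pM ?ler_coord_enorm//.
apply: (le_trans (hi _ yr i)); rewrite ler_wpM2l//.
by apply: ge0_ler_powR; rewrite ?nnegrE ?enorm_ge0 ?(ltW a0).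
Qed.

End gradient.

Lemma enorm_mulmx {R : realType} {n m : nat} (A : 'M[R]_(n, m)) (z : 'rV[R]_n) :
  enorm (z *m A) <= (\sum_j \sum_i `|A i j|) * enorm z.
Proof.
apply: (le_trans (ler_enorm_sum _)); rewrite mulr_suml; apply: ler_sum => j _.
rewrite mxE mulr_suml; apply: le_trans (ler_norm_sum _ _ _) _.
by apply: ler_sum => i _; rewrite normrM mulrC ler_wpM2l// ler_coord_enorm.
Qed.

(** Otherwise each of the [n] terms would be below [1 / n], and their sum below 1. *)
Lemma exists_large_coef {R : realType} {n : nat} (l v : 'I_n -> R) :
  \sum_i l i * v i = 1 -> (forall i, `|v i| <= 1) -> exists j, n%:R^-1 <= `|l j|.
Proof.
move=> lv v1; apply/not_existsP => H.
have n0 : (0 < n)%N.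
  by case: n l v lv {v1 H} => // l v; rewrite big_ord0 => /esym/eqP; rewrite oner_eq0.
have : \sum_i l i * v i < \sum_(i < n) n%:R^-1.
  apply: ltr_sum => [|i _].
    by apply/hasP; exists (Ordinal n0) => //; rewrite mem_index_enum.
  apply: (le_lt_trans (ler_norm _)); rewrite normrM.
  have /negP := H i; rewrite -ltNge; apply: le_lt_trans.
  by rewrite ler_piMr.
by rewrite lv sumr_const card_ord -[ltRHS]mulr_natr mulVf ?ltxx// pnatr_eq0 -lt0n.
Qed.

(** * Coordinates in cylinders and boundary points on graphs *)

Section graph.
Context {R : realType} {n : nat}.
Implicit Types (C : cylinder R n) (E : set 'rV[R]_n) (u : 'rV[R]_n.-1 -> R).

(** A crude common Lipschitz constant of the two coordinate maps; the summand 1 makes it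
    positive. *)
Definition cyl_const C : R := 1 +
  \sum_j \sum_i `|(cyl_horiz C)^T i j| + \sum_j \sum_i `|(cyl_vert C)^T i j|.

Lemma cyl_const_gt0 C : 0 < cyl_const C.
Proof.
by rewrite /cyl_const -addrA ltr_pwDl// addr_ge0//;
  apply: sumr_ge0 => j _; apply: sumr_ge0.
Qed.

Lemma hcoordD C x z : hcoord C (x + z) = hcoord C x + z *m (cyl_horiz C)^T.
Proof. by rewrite /hcoord -mulmxDl addrAC. Qed.

Lemma vcoordD C x z : vcoord C (x + z) = vcoord C x + (z *m (cyl_vert C)^T) 0 0.
Proof. by rewrite /vcoord addrAC mulmxDl [LHS]mxE. Qed.

Lemma enorm_horiz C z : enorm (z *m (cyl_horiz C)^T) <= cyl_const C * enorm z.
Proof.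
apply: (le_trans (enorm_mulmx _ _)); rewrite ler_wpM2r ?enorm_ge0//.
rewrite /cyl_const -addrA addrCA lerDl addr_ge0//.
by apply: sumr_ge0 => j _; apply: sumr_ge0.
Qed.

Lemma norm_vert C z : `|(z *m (cyl_vert C)^T) 0 0| <= cyl_const C * enorm z.
Proof.
apply: (le_trans (ler_coord_enorm _ _)).
apply: (le_trans (enorm_mulmx _ _)); rewrite ler_wpM2r ?enorm_ge0//.
rewrite /cyl_const lerDr addr_ge0//.
by apply: sumr_ge0 => j _; apply: sumr_ge0.
Qed.

Lemma cyl_orthonormalE C :
  cyl_horiz C *m (cyl_vert C)^T = 0 /\ cyl_vert C *m (cyl_vert C)^T = 1%:M.
Proof.
have := cyl_orthonormal C; rewrite tr_col_mx mul_col_row scalar_mx_block.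
by move=> /eq_block_mx[].
Qed.

Lemma open_cyl_set C x : cyl_set C x ->
  exists2 d, 0 < d & forall y, enorm (x - y) < d -> cyl_set C y.
Proof.
move=> [xr xh]; have K0 := cyl_const_gt0 C; set K := cyl_const C in K0 *.
rewrite /cyl_base/= in xr.
pose d := Num.min ((cyl_radius C - enorm (hcoord C x)) / K)
  ((cyl_height C - `|vcoord C x|) / K).
exists d; first by rewrite lt_min !divr_gt0// subr_gt0.
move=> y; rewrite enormB lt_min !ltr_pdivlMr// => /andP[h1 h2].
rewrite -(subrK x y) [_ + x]addrC /cyl_set/= /cyl_base/= hcoordD vcoordD; split.
  apply: (le_lt_trans (ler_enormD _ _)); have := enorm_horiz C (y - x).
  by rewrite -/K mulrC => h; rewrite addrC -ltrBrDr; apply: le_lt_trans h1.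
apply: (le_lt_trans (ler_normD _ _)); have := norm_vert C (y - x).
by rewrite -/K mulrC => h; rewrite addrC -ltrBrDr; apply: le_lt_trans h2.
Qed.

Lemma subgraph_inP C E u y : subgraph_in C E u -> cyl_set C y ->
  E y <-> vcoord C y < u (hcoord C y).
Proof.
move=> sg Cy; split=> [Ey|uy].
  have : (E `&` cyl_set C) y by [].
  by rewrite sg => -[].
have : [set z | cyl_set C z /\ vcoord C z < u (hcoord C z)] y by [].
by rewrite -sg => -[].
Qed.

(** A point of the cylinder below the graph is in the open set [E], hence interior. Near a point
    above it, continuity of [u] leaves no point of [E], against membership in the closure. *)
Lemma bdry_on_graph C E u x : open E -> subgraph_in C E u -> bdry E x ->
  cyl_set C x -> {for hcoord C x, continuous u} -> vcoord C x = u (hcoord C x).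
Proof.
move=> oE sg [clx nix] Cx cu; apply/eqP; rewrite eq_le andbC; apply/andP; split.
  rewrite leNgt; apply/negP => /(subgraph_inP _ _ _ _ sg Cx) Ex; apply: nix.
  exact: (oE x Ex).
rewrite leNgt; apply/negP => ux.
(* Half the gap: close to [x], neither [u] nor the vertical coordinate moves by as much as [e]. *)
have [e e0 eE] : exists2 e, 0 < e & vcoord C x - u (hcoord C x) = e * 2.
  exists ((vcoord C x - u (hcoord C x)) / 2); last by rewrite divfK.
  by rewrite divr_gt0// subr_gt0.
have K0 := cyl_const_gt0 C; set K := cyl_const C in K0 *.
have [d1 d10 Cd1] := open_cyl_set _ _ Cx.
have /nbhs_enormP[d2 d20 ud2] : \forall y \near hcoord C x, `|u (hcoord C x) - u y| < e.
  by move/cvgrPdist_lt : cu; apply.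
pose d := Num.min d1 (Num.min (d2 / K) (e / K)).
have d0 : 0 < d.
  by rewrite !lt_min d10/=; apply/andP; split; exact: divr_gt0.
have [y [Ey xy]] : E `&` [set y | enorm (x - y) < d] !=set0.
  by apply: (clx [set y | enorm (x - y) < d]); apply/nbhs_enormP; exists d.
move: xy; rewrite /= !lt_min => /and3P[xy1 xy2 xy3].
have := Ey => /(subgraph_inP _ _ _ _ sg (Cd1 y xy1)).
rewrite enormB !ltr_pdivlMr// in xy2 xy3.
have yE : y = x + (y - x) by rewrite addrC subrK.
have := ud2 (hcoord C y); rewrite [in hcoord C y]yE hcoordD opprD addNKr enormN.
rewrite -hcoordD -yE => /(_ (le_lt_trans (enorm_horiz _ _) _)).
rewrite mulrC => /(_ xy2).
have := norm_vert C (y - x); rewrite -/K mulrC => /le_lt_trans/(_ xy3).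
rewrite [in vcoord C y]yE vcoordD.
rewrite !ltr_norml => /andP[? ?] /andP[? ?] ?; lra.
Qed.

End graph.

(** * Flatness of boundaries *)

Section graph_is_flat.
Context {R : realType} {n : nat}.
Implicit Types (C : cylinder R n) (E : set 'rV[R]_n) (u : 'rV[R]_n.-1 -> R).

Lemma norm_cyl_vert C i : `|cyl_vert C 0 i| <= 1.
Proof.
have [_ /rowP/(_ 0)] := cyl_orthonormalE C; rewrite !mxE/= => vv.
rewrite -(@expr_le1 _ 2)// -normrX ger0_norm ?sqr_ge0//.
rewrite -[leRHS]vv (bigD1 i)//= mxE -expr2 lerDl sumr_ge0// => j _.
by rewrite mxE -expr2 sqr_ge0.
Qed.

(** Taylor expansion at the boundary point. The centre [c] is independent of [x], so that a single
    ball serves all points of a sequence. *)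
Lemma flat_of_graph (a M r d0 : R) C E u (x : 'rV[R]_n) c : open E -> 0 < a -> 0 <= M ->
  subgraph_in C E u -> bdry E x -> 0 < d0 ->
  (forall y, enorm (x - y) < d0 -> cyl_set C y) ->
  holder_gradient a M r c u -> enorm (hcoord C x - c) + cyl_const C * d0 <= r ->
  flat_at a (n.-1%:R * M * cyl_const C `^ (1 + a)) n%:R^-1 d0 E x.
Proof.
move=> oE a0 M0 sg bx d00 Cx hu xr.
have K0 := cyl_const_gt0 C; set K := cyl_const C in xr K0 *.
have xx : enorm (x - x) < d0 by rewrite subrr enorm0.
have yr : enorm (hcoord C x - c) < r.
  by apply: lt_le_trans xr; rewrite ltrDl mulr_gt0.
have [cu _ _] := hu _ yr.
have ux := bdry_on_graph _ _ _ _ oE sg bx (Cx _ xx) cu.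
set y0 := hcoord C x in yr cu ux xr.
pose g j := partial j u y0.
(* The differential at [x] of the vertical coordinate minus the graph function. It equals 1 on the
   vertical unit vector, hence has a coefficient at least [1 / n] whatever the slope. *)
pose l (i : 'I_n) := cyl_vert C 0 i - \sum_j g j * cyl_horiz C j i.
have [Hv vv] := cyl_orthonormalE C.
have linE (z : 'rV[R]_n) : \sum_i l i * z 0 i =
    (z *m (cyl_vert C)^T) 0 0 - \sum_j g j * (z *m (cyl_horiz C)^T) 0 j.
  rewrite mxE; under [X in _ = _ - X]eq_bigr do rewrite mxE mulr_sumr.
  rewrite exchange_big -sumrB/=; apply: eq_bigr => i _.
  rewrite mxE mulrBl [cyl_vert C 0 i * _]mulrC mulr_suml; congr (_ - _).
  by apply: eq_bigr => j _; rewrite mxE; ring.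
exists l; split.
  apply: (@exists_large_coef R n l (fun i => cyl_vert C 0 i)); last exact: norm_cyl_vert.
  rewrite linE vv mxE eqxx/= big1 ?subr0// => j _.
  have : (cyl_vert C *m (cyl_horiz C)^T) 0 j = (cyl_horiz C *m (cyl_vert C)^T) j 0.
    by have := trmx_mul (cyl_vert C) (cyl_horiz C)^T; rewrite trmxK => <-; rewrite [RHS]mxE.
  by move=> ->; rewrite Hv mxE mulr0.
set M' := _ * _ `^ _.
(* Outside the slab the linear term beats the Taylor remainder, so its sign decides the side of
   [x + z]. *)
have cross (z : 'rV[R]_n) : enorm z < d0 ->
    (M' * enorm z `^ (1 + a) < \sum_i l i * z 0 i -> ~ E (x + z)) /\
    (\sum_i l i * z 0 i < - (M' * enorm z `^ (1 + a)) -> E (x + z)).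
  move=> zd.
  have Cz : cyl_set C (x + z).
    by apply: Cx; rewrite opprD addNKr enormN.
  have zH := enorm_horiz C z.
  have T : `|u (y0 + z *m (cyl_horiz C)^T) - u y0 -
      \sum_j g j * (z *m (cyl_horiz C)^T) 0 j| <= M' * enorm z `^ (1 + a).
    apply: (le_trans (@holder_taylor _ _ a M r c u y0 _ a0 M0 hu _)).
      apply: lt_le_trans xr; rewrite ltrD2l; apply: (le_lt_trans zH).
      by rewrite ltr_pM2l.
    rewrite /M' -[leRHS]mulrA ler_wpM2l ?mulr_ge0//.
    rewrite -powRM ?enorm_ge0 ?(ltW K0)//.
    apply: ge0_ler_powR; rewrite ?nnegrE ?enorm_ge0//.
      by rewrite addr_ge0// ltW.
    by rewrite mulr_ge0 ?enorm_ge0// ltW.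
  have := subgraph_inP _ _ _ _ sg Cz; rewrite vcoordD hcoordD ux -/y0 => EP.
  move: T; rewrite ler_norml linE => /andP[T1 T2]; split.
    by move=> h /EP; lra.
  by move=> h; apply/EP; lra.
move=> y xy; rewrite -sumrB.
have -> : \sum_i (l i * y 0 i - l i * x 0 i) = \sum_i l i * (y - x) 0 i.
  by apply: eq_bigr => i _; rewrite !mxE mulrBr.
rewrite enormB in xy *.
have -> : 2 *: x - y = x + - (y - x).
  by apply/rowP => i; rewrite !mxE; ring.
have {1}-> : y = x + (y - x) by rewrite addrC subrK.
set z := y - x in xy *.
(* Contrapositive: outside the slab [l] takes opposite values at [z] and [- z], so [x + z] and
   [x - z] are on opposite sides and their signs cancel. *)
apply: contra_neqT; rewrite -ltNge lter_normr.
have linN : \sum_i l i * (- z) 0 i = - (\sum_i l i * z 0 i).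
  by rewrite -sumrN; apply: eq_bigr => i _; rewrite mxE mulrN.
have xyN : enorm (- z) < d0 by rewrite enormN.
have [c1 c2] := cross z xy; have [] := cross (- z) xyN.
rewrite enormN linN => c3 c4; rewrite !sgn_setE => /orP[h|h].
  rewrite (memNset (c1 h)) mem_set ?addNr//; apply: c4; lra.
rewrite (memNset (c3 h)) mem_set ?subrr//; apply: c2; lra.
Qed.

Lemma frac_mean_curv_cvg_graph (s a M r : R) C E (E_ : nat -> set 'rV[R]_n) u
    (u_ : nat -> 'rV[R]_n.-1 -> R) (x : 'rV[R]_n) (x_ : nat -> 'rV[R]_n) :
  (0 < n)%N -> open E -> (forall k, open (E_ k)) -> bdry E x ->
  (forall k, bdry (E_ k) (x_ k)) -> x_ k @[k --> \oo] --> x ->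
  volume (E_ k `+` E) @[k --> \oo] --> 0%E ->
  0 < s < a -> 0 <= M -> 0 < r -> cyl_set C x ->
  subgraph_in C E u -> (\forall k \near \oo, subgraph_in C (E_ k) (u_ k)) ->
  holder_gradient a M r (hcoord C x) u ->
  (\forall k \near \oo, holder_gradient a M r (hcoord C x) (u_ k)) ->
  frac_mean_curv s (E_ k) (x_ k) @[k --> \oo] --> frac_mean_curv s E x.
Proof.
move=> n0 oE oE_ bx bx_ xx EE sa M0 r0 Cx sg sg_ hu hu_.
have a0 : 0 < a by case/andP: sa; exact: lt_trans.
have K0 := cyl_const_gt0 C; set K := cyl_const C in K0.
have [d1 d10 Cd1] := open_cyl_set _ _ Cx.
(* The halves leave room to move the centre: for [x_ k] within [d0] of [x], the ball of radius [d0]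
   about [x_ k] stays in the cylinder and its horizontal projection in the ball of radius [r]. *)
pose d0 := Num.min (d1 / 2) (r / K / 2).
have d00 : 0 < d0 by rewrite lt_min; apply/andP; split; rewrite !divr_gt0.
have d0d1 : d0 <= d1 / 2 by rewrite ge_min lexx.
have Kd0 : K * d0 <= r / 2.
  have : d0 <= r / K / 2 by rewrite ge_min lexx orbT.
  by rewrite mulrAC ler_pdivlMr// mulrC.
apply: (@frac_mean_curv_cvg R n s a (n.-1%:R * M * K `^ (1 + a)) n%:R^-1 d0) => //.
- by rewrite mulr_ge0 ?powR_ge0// mulr_ge0.
- by rewrite invr_gt0 ltr0n.
- apply: (flat_of_graph a M r d0 C E u x (hcoord C x)) => //.
    by move=> y xy; apply: Cd1; apply: (lt_le_trans xy); lra.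
  by rewrite subrr enorm0 add0r -/K; lra.
have ce : enorm (x_ k - x) @[k --> \oo] --> 0 by exact: cvg_enormB.
near=> k.
have xkd : enorm (x_ k - x) < d0.
  rewrite -[ltLHS]ger0_norm ?enorm_ge0//; near: k; exact: (cvgr0_norm_lt _ ce).
apply: (flat_of_graph a M r d0 C (E_ k) (u_ k) (x_ k) (hcoord C x)) => //.
- by near: k.
- move=> y xy; apply: Cd1; rewrite -(subrKA (x_ k)); apply: le_lt_trans (ler_enormD _ _) _.
  rewrite (enormB x); lra.
- by near: k.
- have := enorm_horiz C (x_ k - x); rewrite -/K.
  rewrite -[in hcoord C (x_ k)](subrK x (x_ k)) [_ - x + x]addrC hcoordD addrAC subrr add0r => h.
  have : K * enorm (x_ k - x) < K * d0 by rewrite ltr_pM2l.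
  rewrite -/K; lra.
Unshelve. all: by end_near. Qed.

End graph_is_flat.

(** * Uniform bounds on gradients *)

Lemma ler_sum_term {R : realType} {I : finType} (f : I -> R) i :
  (forall j, 0 <= f j) -> f i <= \sum_j f j.
Proof. by move=> f0; rewrite (bigD1 i)//= lerDl sumr_ge0. Qed.

Section norms.
Context {R : realType} {m : nat}.
Implicit Types (D : set 'rV[R]_m) (u v : 'rV[R]_m -> R) (y z c : 'rV[R]_m).

Lemma sup_norm_ge0 D u : D !=set0 -> (0 <= sup_norm D u)%E.
Proof.
move=> [y Dy]; apply: (@le_trans _ _ `|u y|%:E); first by rewrite lee_fin.
by apply: ereal_sup_ubound; exists y.
Qed.

Lemma Ck_norm_ge0 k D u : D !=set0 -> (0 <= Ck_norm k D u)%E.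
Proof.
move=> D0; elim: k u => [|k IH] u /=; rewrite adde_ge0 ?sup_norm_ge0//.
by apply: sume_ge0 => i _; exact: IH.
Qed.

Lemma holder_seminorm_ge0 a D u y z : D y -> D z -> y != z ->
  (0 <= holder_seminorm a D u)%E.
Proof.
move=> Dy Dz yz; apply: (@le_trans _ _ (`|u y - u z| / enorm (y - z) `^ a)%:E).
  by rewrite lee_fin divr_ge0 ?powR_ge0.
by apply: ereal_sup_ubound; exists y, z.
Qed.

Lemma sup_norm_le D u (M : R) y : (sup_norm D u <= M%:E)%E -> D y -> `|u y| <= M.
Proof.
move=> uM Dy; rewrite -lee_fin; apply: le_trans uM.
by apply: ereal_sup_ubound; exists y.
Qed.

Lemma holder_seminorm_le a D u (M : R) y z : (holder_seminorm a D u <= M%:E)%E ->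
  D y -> D z -> 0 <= M -> `|u y - u z| <= M * enorm (y - z) `^ a.
Proof.
move=> uM Dy Dz M0; have [->|yz] := eqVneq y z.
  by rewrite subrr normr0 mulr_ge0 ?powR_ge0.
have e0 : 0 < enorm (y - z).
  rewrite lt_neqAle enorm_ge0 andbT eq_sym; apply: contra_neq yz => /enorm_eq0 H.
  by apply/eqP; rewrite -subr_eq0 H.
rewrite -ler_pdivrMr ?powR_gt0// -lee_fin; apply: le_trans uM.
by apply: ereal_sup_ubound; exists y, z.
Qed.

Lemma le_sume_term (I : finType) (f : I -> \bar R) i :
  (forall j, (0 <= f j)%E) -> (f i <= \sum_j f j)%E.
Proof. by move=> f0; rewrite (bigD1 i)//= leeDl// sume_ge0. Qed.

Lemma Ck_norm_partial k D u i : D !=set0 ->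
  (Ck_norm k D (partial i u) <= Ck_norm k.+1 D u)%E.
Proof.
move=> D0 /=; apply: (@le_trans _ _ (\sum_(j < m) Ck_norm k D (partial j u))%E).
  by apply: (le_sume_term _ (fun j => Ck_norm k D (partial j u))) => j; exact: Ck_norm_ge0.
by rewrite leeDr// sup_norm_ge0.
Qed.

Lemma partial_sub u v i y : derivable u y (delta_mx 0 i) ->
  derivable v y (delta_mx 0 i) ->
  partial i (u \- v) y = partial i u y - partial i v y.
Proof. by move=> du dv; exact: deriveB. Qed.

(** The mean value formula applied to each first partial. With [y] and [y'] in the ball of radius
    [r / 3], the intermediate points are within [2 r / 3] of [y'], hence in the ball of radius
    [r]. *)
Lemma hessian_holder (M r : R) u c : 0 <= M -> 0 < r ->
  (forall y, enorm (y - c) < r -> [/\ {for y, continuous u},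
     forall i, derivable u y (delta_mx 0 i),
     forall i j, derivable (partial i u) y (delta_mx 0 j) &
     forall i j, `|partial j (partial i u) y| <= M]) ->
  holder_gradient 1 (m%:R * M) (r / 3) c u.
Proof.
move=> M0 r0 hu y yr.
have yr1 : enorm (y - c) < r by apply: lt_trans yr _; rewrite gtr_pMr//; lra.
have [cu du _ _] := hu y yr1; split=> // y' yr' i.
have inr w : enorm (w - y') <= enorm (y - y') -> enorm (w - c) < r.
  move=> h; rewrite -(subrKA y' w (- c)); apply: le_lt_trans (ler_enormD _ _) _.
  have : enorm (y - y') <= enorm (y - c) + enorm (y' - c).
    by rewrite -(subrKA c y (- y')) (enormB y' c) ler_enormD.
  lra.
have [j w wz|xi [xiz]] := @coordinatewise_mean_value R m (partial i u) y' (y - y').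
  by have [_ _ + _] := hu w (inr w wz); apply.
rewrite (addrC y') subrK => ->.
apply: le_trans (ler_norm_sum _ _ _) _; rewrite powRr1 ?enorm_ge0//.
rewrite -mulrA -[X in X%:R]card_ord -sum1_card natr_sum mulr_suml.
apply: ler_sum => j _; rewrite mul1r normrM ler_pM ?ler_coord_enorm//.
by have [_ _ _] := hu _ (inr _ (xiz j)); apply.
Qed.

End norms.

(** * Uniform Holder bounds along convergent sequences of graphs *)

Section convergence_classes.
Context {R : realType} {n : nat}.
Implicit Types (C : cylinder R n) (u : 'rV[R]_n.-1 -> R) (c : 'rV[R]_n.-1).

Lemma cyl_base_ball C c y : enorm (y - c) < cyl_radius C - enorm c -> cyl_base C y.
Proof.
by rewrite ltrBrDr => h; apply: le_lt_trans h; rewrite -[y in enorm y](subrK c) ler_enormD.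
Qed.

Lemma cyl_base_nonempty C : cyl_base C !=set0.
Proof. by exists 0; rewrite /cyl_base/= enorm0; exact: cyl_radius_gt0. Qed.

Lemma near_norm_lt1 (f : nat -> \bar R) : f k @[k --> \oo] --> 0%E ->
  \forall k \near \oo, (f k < 1%:E)%E.
Proof.
move=> f0; have : \forall y \near (0%E : \bar R), (y < 1%:E)%E by exact: lt_nbhsl.
exact: f0.
Qed.

Lemma holder_gradient_C1a (a M : R) C u c : (forall i,
    (holder_seminorm a (cyl_base C) (partial i u) <= M%:E)%E) -> 0 <= M ->
  is_Ck 1 (cyl_base C) u ->
  holder_gradient a M (cyl_radius C - enorm c) c u.
Proof.
move=> hM M0 [cu du] y yr; have Dy := cyl_base_ball _ _ _ yr; split.
- by apply: cu; rewrite inE.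
- by move=> i; have [+ _] := du i; apply.
- move=> y' yr' i; apply: holder_seminorm_le => //; exact: cyl_base_ball yr'.
Qed.

(** The seminorms for [u] are finite with a common bound [M], and those of the differences are
    eventually below 1, so [M + 1] works for the limit and for all large [k]. *)
Lemma C1a_uniform_holder (a : R) C u (u_ : nat -> 'rV[R]_n.-1 -> R) c :
  (2 <= n)%N -> 0 < a ->
  is_C1a a (cyl_base C) u -> (\forall k \near \oo, is_C1a a (cyl_base C) (u_ k)) ->
  C1a_norm a (cyl_base C) (u_ k \- u)%R @[k --> \oo] --> 0%E ->
  exists2 M, 0 <= M &
    holder_gradient a M (cyl_radius C - enorm c) c u /\
    \forall k \near \oo, holder_gradient a M (cyl_radius C - enorm c) c (u_ k).
Proof.
move=> n2 a0 [uC uh] uC_ cv; set D := cyl_base C in uC uh uC_ cv *.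
have D0 : D !=set0 := cyl_base_nonempty C.
have n1 : (0 < n.-1)%N by case: n n2 => [|[]].
(* The base has positive dimension, so it contains two distinct points; a supremum over no pair
   would be [-oo] and spoil the sums. *)
have hs0 v : (0 <= holder_seminorm a D v)%E.
  have r0 := cyl_radius_gt0 C.
  pose z : 'rV[R]_n.-1 := (cyl_radius C / 2) *: delta_mx 0 (Ordinal n1).
  have zr : enorm z <= cyl_radius C / 2.
    apply: (le_trans (ler_enorm_sum _)); rewrite (bigD1 (Ordinal n1))//= big1.
      by rewrite addr0 !mxE !eqxx mulr1 ger0_norm// divr_ge0// ltW.
    by move=> i i0; rewrite !mxE eqxx/= (negbTE i0) mulr0 normr0.
  apply: (@holder_seminorm_ge0 _ _ a D v z 0).
  - by rewrite /D/cyl_base/=; apply: (le_lt_trans zr); rewrite gtr_pMr//; lra.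
  - by rewrite /D/cyl_base/= enorm0.
  - apply/negP => /eqP/rowP/(_ (Ordinal n1)); rewrite !mxE !eqxx mulr1 => /eqP.
    by rewrite gt_eqF// divr_gt0.
have uf i : exists2 M : R, 0 <= M & (holder_seminorm a D (partial i u) <= M%:E)%E.
  exists (fine (holder_seminorm a D (partial i u))); first exact: fine_ge0.
  by rewrite fineK// ge0_fin_numE.
pose Mi i := sval (cid2 (uf i)).
have Mi0 i : 0 <= Mi i by rewrite /Mi; case: cid2.
have uMi i : (holder_seminorm a D (partial i u) <= (Mi i)%:E)%E by rewrite /Mi; case: cid2.
pose M := \sum_i Mi i.
have M0 : 0 <= M by apply: sumr_ge0.
have uM i : (holder_seminorm a D (partial i u) <= M%:E)%E.
  apply: (le_trans (uMi i)); rewrite lee_fin /M (bigD1 i)//= lerDl.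
  by apply: sumr_ge0.
exists (M + 1); first by rewrite addr_ge0.
split.
  apply: holder_gradient_C1a => //; last by rewrite addr_ge0.
  by move=> i; apply: (le_trans (uM i)); rewrite lee_fin lerDl.
have cv1 := near_norm_lt1 _ cv.
near=> k.
have [kC _] : is_C1a a D (u_ k) by near: k.
apply: holder_gradient_C1a => //; last by rewrite addr_ge0.
move=> i; apply: ge_ereal_sup => _ [y [z [Dy Dz yz ->]]].
have e0 : 0 < enorm (y - z).
  rewrite lt_neqAle enorm_ge0 andbT eq_sym; apply: contra_neq yz => /enorm_eq0 H.
  by apply/eqP; rewrite -subr_eq0 H.
rewrite lee_fin ler_pdivrMr ?powR_gt0//.
have k1 : (holder_seminorm a D (partial i (u_ k \- u)%R) <= 1%:E)%E.
  have : (C1a_norm a D (u_ k \- u)%R < 1%:E)%E by near: k.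
  move=> /ltW; apply: le_trans; rewrite /C1a_norm.
  apply: (@le_trans _ _ (\sum_(j < n.-1) holder_seminorm a D (partial j (u_ k \- u)%R))%E).
    exact: (le_sume_term _ (fun j => holder_seminorm a D (partial j (u_ k \- u)%R))).
  by rewrite leeDr// Ck_norm_ge0.
have hd := holder_seminorm_le _ _ _ _ _ _ k1 Dy Dz ler01.
have hu := holder_seminorm_le _ _ _ _ _ _ (uM i) Dy Dz M0.
have dk w : D w -> partial i (u_ k \- u)%R w = partial i (u_ k) w - partial i u w.
  move=> Dw; apply: partial_sub.
    by have [_ /(_ i)[+ _]] := kC; apply.
  by have [_ /(_ i)[+ _]] := uC; apply.
rewrite !dk// in hd.
rewrite (_ : partial i (u_ k) y - partial i (u_ k) z =
  (partial i u y - partial i u z) +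
  ((partial i (u_ k) y - partial i u y) - (partial i (u_ k) z - partial i u z))); last by ring.
by rewrite mulrDl; apply: le_trans (ler_normD _ _) _; apply: lerD.
Unshelve. all: by end_near. Qed.

(** Second partials are continuous but may be unbounded on the base, so the bound is taken on a
    small ball about [c]; there those of [u_ k] eventually exceed it by at most 1. *)
Lemma C2_uniform_holder C u (u_ : nat -> 'rV[R]_n.-1 -> R) c :
  cyl_base C c ->
  is_Ck 2 (cyl_base C) u -> (\forall k \near \oo, is_Ck 2 (cyl_base C) (u_ k)) ->
  Ck_norm 2 (cyl_base C) (u_ k \- u)%R @[k --> \oo] --> 0%E ->
  exists M r, [/\ 0 <= M, 0 < r,
    holder_gradient 1 M r c u &
    \forall k \near \oo, holder_gradient 1 M r c (u_ k)].
Proof.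
set D := cyl_base C => Dc uC uC_ cv.
have D0 : D !=set0 := cyl_base_nonempty C.
have Dball y : enorm (y - c) < cyl_radius C - enorm c -> D y by exact: cyl_base_ball.
have rc : 0 < cyl_radius C - enorm c by rewrite subr_gt0.
have oD y : D y -> \near y, D y.
  move=> Dy; apply/nbhs_enormP; exists (cyl_radius C - enorm y).
    by rewrite subr_gt0.
  by move=> z; rewrite enormB; exact: cyl_base_ball.
have [cu du] := uC.
pose M0 := \sum_i \sum_j `|partial j (partial i u) c| + 1.
have M00 : 0 <= M0 by rewrite addr_ge0// sumr_ge0// => i _; apply: sumr_ge0.
have /nbhs_enormP[r1 r10 ur1] : \forall y \near c, forall i j,
    `|partial j (partial i u) y| <= M0.
  apply: (@filter_forall _ _
    (fun i y => forall j, `|partial j (partial i u) y| <= M0) (nbhs c)) => i.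
  apply: (@filter_forall _ _
    (fun j y => `|partial j (partial i u) y| <= M0) (nbhs c)) => j.
  have [_ [_ /(_ j)[_ [cuij _]]]] := du i.
  have hc : `|partial j (partial i u) c| <= \sum_i \sum_j `|partial j (partial i u) c|.
    apply: (le_trans (ler_sum_term (fun j => `|partial j (partial i u) c|) j _)) => //.
    apply: (ler_sum_term (fun i => \sum_j `|partial j (partial i u) c|) i) => i'.
    exact: sumr_ge0.
  have near1 : \forall y \near c,
      `|partial j (partial i u) c - partial j (partial i u) y| < 1.
    by move/cvgrPdist_lt : (cuij c (mem_set Dc)); apply.
  near=> y.
  have h : `|partial j (partial i u) c - partial j (partial i u) y| < 1 by near: y.
  rewrite -(subrK (partial j (partial i u) c) (partial j (partial i u) y)).
  by apply: le_trans (ler_normD _ _) _; rewrite distrC /M0 [leRHS]addrC lerD// ltW.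
pose r := Num.min r1 (cyl_radius C - enorm c).
have r0 : 0 < r by rewrite lt_min r10.
have rin y : enorm (y - c) < r -> D y /\ forall i j, `|partial j (partial i u) y| <= M0.
  by rewrite lt_min => /andP[h1 h2]; split; [exact: Dball|apply: ur1; rewrite enormB].
have hess v : is_Ck 2 D v -> (forall y, enorm (y - c) < r -> forall i j,
    `|partial j (partial i v) y| <= M0 + 1) ->
    holder_gradient 1 (n.-1%:R * (M0 + 1)) (r / 3) c v.
  move=> [cv1 dv] hv; apply: hessian_holder => //; first by rewrite addr_ge0.
  move=> y yr; have [Dy _] := rin y yr; split.
  - by apply: cv1; rewrite inE.
  - by move=> i; have [+ _] := dv i; apply.
  - by move=> i j; have [_ [_ /(_ j)[+ _]]] := dv i; apply.
  - exact: hv.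
exists (n.-1%:R * (M0 + 1)), (r / 3); split.
- by rewrite mulr_ge0// addr_ge0.
- by rewrite divr_gt0.
- apply: hess => // y /rin[_ h] i j; apply: (le_trans (h i j)); by rewrite lerDl.
have cv1 := near_norm_lt1 _ cv.
near=> k.
have kC : is_Ck 2 D (u_ k) by near: k.
apply: hess => // y yr i j; have [Dy hu] := rin y yr.
have [ck dk] := kC.
have dd (w : 'rV[R]_n.-1) : D w ->
    partial i (u_ k \- u)%R w = (partial i (u_ k) \- partial i u) w.
  move=> Dw; apply: partial_sub.
    by have [+ _] := dk i; apply.
  by have [+ _] := du i; apply.
(* The first partials of the difference split on the open set [D], hence near [y], which permits
   differentiating the identity again. *)
have E : partial j (partial i (u_ k \- u)%R) y =
    partial j (partial i (u_ k)) y - partial j (partial i u) y.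
  rewrite -partial_sub.
  - by apply: near_eq_derive; apply: filterS (oD y Dy) => w; exact: dd.
  - by have [_ [_ /(_ j)[+ _]]] := dk i; apply.
  - by have [_ [_ /(_ j)[+ _]]] := du i; apply.
have k1 : (sup_norm D (partial j (partial i (u_ k \- u)%R)) <= 1%:E)%E.
  have : (Ck_norm 2 D (u_ k \- u)%R < 1%:E)%E by near: k.
  move=> /ltW; apply: le_trans.
  apply: (le_trans _ (Ck_norm_partial 1 _ _ i D0)).
  apply: (le_trans _ (Ck_norm_partial 0 _ _ j D0)).
  by rewrite /= adde0.
have := sup_norm_le _ _ _ _ k1 Dy; rewrite E => h.
rewrite -(subrK (partial j (partial i u) y) (partial j (partial i (u_ k)) y)).
by apply: le_trans (ler_normD _ _) _; rewrite addrC lerD.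
Unshelve. all: by end_near. Qed.

End convergence_classes.

(** * Convergence of curvatures in the Holder and [C^2] classes *)

Theorem proposition0p8 (R : realType) (n : nat) (hn : (2 <= n)%N)
    (E : set 'rV[R]_n) (E_ : nat -> set 'rV[R]_n)
    (x : 'rV[R]_n) (x_ : nat -> 'rV[R]_n)
    (oE : open E) (bE : bounded_set E)
    (oE_ : forall k, open (E_ k)) (bE_ : forall k, bounded_set (E_ k))
    (hx : bdry E x) (hx_ : forall k, bdry (E_ k) (x_ k))
    (cvg_x : x_ k @[k --> \oo] --> x) :
  (forall a : R, 0 < a <= 1 ->
     C1a_boundary a E -> (forall k, C1a_boundary a (E_ k)) ->
     C1a_cvg a E_ E ->
     forall s : R, 0 < s < a ->
       frac_mean_curv s (E_ k) (x_ k) @[k --> \oo] --> frac_mean_curv s E x)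
  /\
  (C2_boundary E -> (forall k, C2_boundary (E_ k)) ->
     C2_cvg E_ E ->
     forall s : R, 0 < s < 1 ->
       frac_mean_curv s (E_ k) (x_ k) @[k --> \oo] --> frac_mean_curv s E x).
Proof.
have n0 : (0 < n)%N by apply: leq_trans hn.
split.
  move=> a /andP[a0 a1] _ _ [EE [N [C [u [u_ [EC _ H]]]]]] s sa.
  (* The analysis near the singularity takes place in a cylinder containing [x]; away from it,
     convergence in volume is enough. *)
  have [i _ Cx] := EC x hx; have [[uC sg] near_k cv] := H i.
  have [|M M0 [hu hu_]] := @C1a_uniform_holder R n a (C i) (u i) (u_ ^~ i)
      (hcoord (C i) x) hn a0 uC _ cv.
  - by apply: filterS near_k => k [].
  apply: (@frac_mean_curv_cvg_graph R n s a M _ (C i) E E_ (u i) (u_ ^~ i)) hu hu_ => //.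
  - by rewrite subr_gt0; case: Cx.
  - by apply: filterS near_k => k [].
move=> _ _ [EE [N [C [u [u_ [EC _ H]]]]]] s s1.
have [i _ Cx] := EC x hx; have [[uC sg] near_k cv] := H i.
have [||M [r [M0 r0 hu hu_]]] := @C2_uniform_holder R n (C i) (u i) (u_ ^~ i)
    (hcoord (C i) x) _ uC _ cv.
- by case: Cx.
- by apply: filterS near_k => k [].
(* Lipschitz gradients give flatness of exponent 1, which admits every [s] below 1. *)
apply: (@frac_mean_curv_cvg_graph R n s 1 M r (C i) E E_ (u i) (u_ ^~ i)) hu hu_ => //.
by apply: filterS near_k => k [].
Qed.
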